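(* Let $\varphi\in[0,2\pi)$, $n\ge1$, and let $L_1,\dots,L_n$ be normal operators on $\mathbb{C}^2\otimes\mathbb{C}^2$. The family $\{L_1,\dots,L_n\}$ enforces nontrivial phase-locking with phase shift $\varphi$ (as defined in the context) if and only if, after multiplying each $L_j$ by a suitable complex number of modulus one, at least one of the following holds: (1) every $L_j$ belongs to $\mathcal S_1(\varphi)$, with parameters $(a_j,b_j,c_j,k_j,m_j)$, and either $b_j\neq0$ for some $j$, or there are indices $j,l$ (possibly equal) with $a_j\neq c_j$ and $m_l\neq0$; (2) every $L_j$ belongs to $\mathcal S_2(\varphi)$, with parameters $(a_j,b_j,c_j,k_j,m_j)$, and either $b_j\neq0$ for some $j$, or there are indices $j,l$ (possibly equal) with $a_j+m_je^{ik_j}\neq c_j$ and $m_l\neq0$; (3) there is $\theta\in(-\frac\pi2,0)\cup(0,\frac\pi2)$ such that every $L_j$ belongs to $\mathcal S_\theta(\varphi)$, with parameters $(a_j,b_j,k_j,m_j)$, and $b_j\neq0$ for some $j$.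
   Context: Two qubits $A$ (first factor) and $B$ (second factor), Hilbert space $\mathscr H=\mathbb{C}^2\otimes\mathbb{C}^2$, $|ij\rangle=|i\rangle\otimes|j\rangle$; matrices are in the ordered basis $(|00\rangle,|01\rangle,|10\rangle,|11\rangle)$. The free Hamiltonian is $H=H_0\otimes I+I\otimes H_0$ with $H_0=\mathrm{diag}(E_0,E_1)$, $E_0,E_1\in\mathbb{R}$, $\Delta E=E_0-E_1\neq0$. The generator is $\mathcal L(\rho)=-i[H,\rho]+\sum_{j=1}^n\left(L_j\rho L_j^\dagger-\frac12\{L_j^\dagger L_j,\rho\}\right)$ and $\mathcal T_t=e^{t\mathcal L}$. The attractor space $\mathrm{Att}(\mathcal T)$ is the direct sum of $\ker(\mathcal L-\lambda I)$ over all purely imaginary eigenvalues $\lambda$ (including $0$) of $\mathcal L$. Put $X_{\Delta E}=\mathrm{span}\{|00\rangle\langle01|,|00\rangle\langle10|,|01\rangle\langle11|,|10\rangle\langle11|\}$. $\mathrm{Tr}_A$, $\mathrm{Tr}_B$ are the partial traces over the first and second factor. The family enforces nontrivial phase-locking with phase shift $\varphi$ if $\mathrm{Tr}_A X=e^{i\varphi}\,\mathrm{Tr}_B X$ for every $X\in\mathrm{Att}(\mathcal T)\cap X_{\Delta E}$ and there is at least one such $X$ with $\mathrm{Tr}_B X\neq 0$. Sets of operators. $\mathcal S_1(\varphi)$: operators $T_1\begin{pmatrix} c&0&0&0\\ 0&c&0&0\\ 0&0&a&b\\ 0&0&e^{2ik}\bar b&a+me^{ik}\end{pmatrix}T_1^\dagger$,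 $T_1=\begin{pmatrix}1&0&0&0\\ 0&\frac1{\sqrt2}&\frac1{\sqrt2}&0\\ 0&\frac{e^{i\varphi}}{\sqrt2}&-\frac{e^{i\varphi}}{\sqrt2}&0\\ 0&0&0&1\end{pmatrix}$, with $a,b\in\mathbb{C}$, $c,k,m\in\mathbb{R}$. $\mathcal S_2(\varphi)$: operators $T_2\begin{pmatrix} a&b&0&0\\ e^{2ik}\bar b&a+me^{ik}&0&0\\ 0&0&c&0\\ 0&0&0&c\end{pmatrix}T_2^\dagger$, $T_2=\begin{pmatrix}1&0&0&0\\ 0&\frac1{\sqrt2}&\frac1{\sqrt2}&0\\ 0&-\frac{e^{i\varphi}}{\sqrt2}&\frac{e^{i\varphi}}{\sqrt2}&0\\ 0&0&0&1\end{pmatrix}$, with $a,b\in\mathbb{C}$, $c,k,m\in\mathbb{R}$. $\mathcal S_\theta(\varphi)$: operators $T_\theta\begin{pmatrix} a&b&0&0\\ e^{2ik}\bar b&a+me^{ik}&0&0\\ 0&0&a&e^{-2i\theta}b\\ 0&0&e^{2i\theta}e^{2ik}\bar b&a+me^{ik}\end{pmatrix}T_\theta^\dagger$, $T_\theta=\begin{pmatrix}1&0&0&0\\ 0&ie^{-i\varphi}\sin\theta&\cos\theta&0\\ 0&-\cos\theta&-ie^{i\varphi}\sin\theta&0\\ 0&0&0&1\end{pmatrix}$, with $a,b\in\mathbb{C}$, $k,m\in\mathbb{R}$. *)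

(* Defs.v *)
From HB Require Import structures.
From mathcomp Require Import all_boot all_order all_algebra.
From mathcomp Require Import all_classical all_reals all_analysis.
From mathcomp Require Import complex mxtens.

Set Implicit Arguments.
Unset Strict Implicit.
Unset Printing Implicit Defensive.

Import Order.TTheory GRing.Theory Num.Theory.

Local Open Scope ring_scope.
Local Open Scope complex_scope.
Local Open Scope sesquilinear_scope.

Notation "A *t B" := (tensmx A B)
  (at level 40, left associativity, format "A  *t  B") : ring_scope.

(** Operators on C^2 (x) C^2 have type ['M[R[i]]_(2 * 2)]; the tensor index
    [mxtens_index (i, j)] has value [2 * i + j], so rows and columns are in the
    order |00>, |01>, |10>, |11>. *)

Section TwoQubits.
Variable R : realType.
Local Notation C := R[i].
Local Notation op := 'M[C]_(2 * 2).

(** e^(i x) for real x. *)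
Definition expi (x : R) : C := cos x +i* sin x.

Definition mx4 (rows : seq (seq C)) : op :=
  \matrix_(i < 2 * 2, j < 2 * 2) (nth [::] rows i)`_j.

Section Dynamics.
Variables (E0 E1 : R) (n : nat) (L : 'I_n -> op).

Definition qubit_hamiltonian : 'M[C]_2 :=
  diag_mx (\row_(j < 2) [:: E0%:C; E1%:C]`_j).

Definition hamiltonian : op :=
  qubit_hamiltonian *t 1%:M + 1%:M *t qubit_hamiltonian.

Definition generator (rho : op) : op :=
  - ('i *: (hamiltonian *m rho - rho *m hamiltonian))
  + \sum_(j < n)
      (L j *m rho *m (L j)^t*
       - 2^-1 *: ((L j)^t* *m L j *m rho + rho *m ((L j)^t* *m L j))).

Fact generator_is_linear : linear generator.
Proof.
move=> z x y; rewrite /generator [z *: (_ + _)]scalerDr [RHS]addrACA.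
congr (_ + _).
  rewrite mulmxDr [(z *: x + y) *m _]mulmxDl -scalemxAr -scalemxAl.
  rewrite opprD addrACA -scalerBr.
  by rewrite scalerDr opprD scalerN !scalerA mulrC.
rewrite scaler_sumr -big_split; apply: eq_bigr => j _ /=.
rewrite !(mulmxDr, mulmxDl) -!(scalemxAr, scalemxAl).
rewrite [X in 2^-1 *: X]addrACA -scalerDr [2^-1 *: (_ + _)]scalerDr opprD addrACA.
congr (_ + _).
by rewrite scalerBr !scalerA mulrC.
Qed.
HB.instance Definition _ :=
  GRing.isLinear.Build C op op *:%R generator generator_is_linear.

(** The attractor space. The eigenvalues being finitely many and eigenspaces
    of distinct eigenvalues being independent, membership in the direct sum
    means membership in a finite sum of the relevant eigenspaces. *)
Definition attractor (X : op) : Prop :=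
  exists s : seq C,
    [/\ uniq s,
        forall lambda, lambda \in s ->
          passmx.leigenvalue (linfun generator) lambda /\ 'Re lambda = 0
      & X \in (\sum_(lambda <- s) passmx.leigenspace (linfun generator) lambda)%VS].

End Dynamics.

Definition ket (i j : 'I_2) : 'cV[C]_(2 * 2) :=
  (delta_mx i 0 : 'cV[C]_2) *t (delta_mx j 0 : 'cV[C]_2).

Definition ketbra (i j k l : 'I_2) : op := ket i j *m (ket k l)^t*.

Definition X_DeltaE : {vspace op} :=
  span [:: ketbra 0 0 0 1; ketbra 0 0 1 0; ketbra 0 1 1 1; ketbra 1 0 1 1].

(** Partial traces over the first factor and over the second factor. *)
Definition trA (X : op) : 'M[C]_2 :=
  \matrix_(i < 2, j < 2)
    \sum_(k < 2) X (mxtens_index (k, i)) (mxtens_index (k, j)).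
Definition trB (X : op) : 'M[C]_2 :=
  \matrix_(i < 2, j < 2)
    \sum_(k < 2) X (mxtens_index (i, k)) (mxtens_index (j, k)).

Definition phase_locking (E0 E1 : R) (n : nat) (L : 'I_n -> op) (phi : R) :
    Prop :=
  (forall X, attractor E0 E1 L X -> X \in X_DeltaE ->
     trA X = expi phi *: trB X)
  /\ (exists X, [/\ attractor E0 E1 L X, X \in X_DeltaE & trB X != 0]).

Section Families.
Variable phi : R.
Local Notation r2 := ((Num.sqrt 2)^-1%:C).

Definition T1 : op := mx4
  [:: [:: 1; 0;             0;                  0];
      [:: 0; r2;            r2;                 0];
      [:: 0; expi phi * r2; - (expi phi * r2);  0];
      [:: 0; 0;             0;                  1] ].

Definition S1 (a b : C) (c k m : R) : op :=
  T1 *m mx4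
  [:: [:: c%:C; 0;    0;                    0];
      [:: 0;    c%:C; 0;                    0];
      [:: 0;    0;    a;                    b];
      [:: 0;    0;    expi (2 * k) * b^*;   a + m%:C * expi k] ] *m T1^t*.

Definition T2 : op := mx4
  [:: [:: 1; 0;                 0;             0];
      [:: 0; r2;                r2;            0];
      [:: 0; - (expi phi * r2); expi phi * r2; 0];
      [:: 0; 0;                 0;             1] ].

Definition S2 (a b : C) (c k m : R) : op :=
  T2 *m mx4
  [:: [:: a;                  b;                 0;    0];
      [:: expi (2 * k) * b^*; a + m%:C * expi k; 0;    0];
      [:: 0;                  0;                 c%:C; 0];
      [:: 0;                  0;                 0;    c%:C] ] *m T2^t*.

Definition Ttheta (theta : R) : op := mx4
  [:: [:: 1; 0; 0; 0];
      [:: 0; 'i * expi (- phi) * (sin theta)%:C; (cos theta)%:C; 0];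
      [:: 0; - (cos theta)%:C; - ('i * expi phi * (sin theta)%:C); 0];
      [:: 0; 0; 0; 1] ].

Definition Stheta (theta : R) (a b : C) (k m : R) : op :=
  Ttheta theta *m mx4
  [:: [:: a; b; 0; 0];
      [:: expi (2 * k) * b^*; a + m%:C * expi k; 0; 0];
      [:: 0; 0; a; expi (- (2 * theta)) * b];
      [:: 0; 0; expi (2 * theta) * expi (2 * k) * b^*; a + m%:C * expi k] ]
  *m (Ttheta theta)^t*.

End Families.
End TwoQubits.

(* Main.v *)
(** For normal [L_j] the dissipator satisfies
    [2 Re <X, D X> = - sum_j ||[L_j, X]||^2] in the trace inner product, so an
    eigenvector of the generator for an imaginary eigenvalue commutes with
    every [L_j], and by Fuglede with every [L_j^*].  Since the whole of
    [X_DeltaE] is one eigenspace of the commutator with [H], the attractors in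
    it are the [X = |00><p| + |q><11|], with [p, q] in the span of [|01>, |10>],
    that commute with all [L_j], and phase-locking becomes a linear condition
    on [p, q].

    With [X] the commutant contains [X X^* X] and [X X X^*], hence
    [(|p|^2 - |q|^2) |00><p|] and [<p|q> |00><q|].  Let [X] have nonzero
    partial trace.  If [q = 0], [p = 0], [|p| <> |q|] or [<p|q> <> 0], the
    commutant therefore contains an element with one of its two summands
    missing; the locking condition makes it a multiple of [|00><f|] or of
    [|f><11|], with [f] proportional to [|01> + e^(i phi) |10>], and this forces
    the block form [S1] or [S2].  If [p] and [q] are orthogonal of equal norm,
    the locking condition determines [X] up to a factor and one angle [theta],
    which forces the block form [S_theta]. *)
Require Import Defs.
From mathcomp Require Import all_boot all_order all_algebra.
From mathcomp Require Import all_classical all_reals all_analysis.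
From mathcomp Require Import complex mxtens.
From mathcomp Require Import ring lra.

Set Implicit Arguments.
Unset Strict Implicit.
Unset Printing Implicit Defensive.

Import Order.TTheory GRing.Theory Num.Theory.

Local Open Scope ring_scope.
Local Open Scope complex_scope.

(** * Normal matrices, the trace inner product and Fuglede's theorem *)

Section Adjoint.
Local Open Scope sesquilinear_scope.
Local Open Scope ring_scope.
Variables (C : numClosedFieldType).

Lemma adjmxM m n p (A : 'M[C]_(m, n)) (B : 'M[C]_(n, p)) :
  (A *m B)^t* = B^t* *m A^t*.
Proof. by rewrite trmx_mul map_mxM. Qed.

Lemma adjmxD m n (A B : 'M[C]_(m, n)) : (A + B)^t* = A^t* + B^t*.
Proof. by rewrite linearD map_mxD. Qed.

Lemma adjmxN m n (A : 'M[C]_(m, n)) : (- A)^t* = - A^t*.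
Proof. by rewrite linearN map_mxN. Qed.

Lemma adjmxZ m n (z : C) (A : 'M[C]_(m, n)) : (z *: A)^t* = z^* *: A^t*.
Proof. by rewrite linearZ map_mxZ. Qed.

Lemma adjmx_sum n (I : finType) (F : I -> 'M[C]_n) :
  (\sum_i F i)^t* = \sum_i (F i)^t*.
Proof. by rewrite linear_sum raddf_sum. Qed.

Lemma mxtraceB n (A B : 'M[C]_n) : \tr (A - B) = \tr A - \tr B.
Proof. exact: raddfB. Qed.

(** The squared Hilbert-Schmidt norm. *)
Definition frob n (A : 'M[C]_n) : C := \tr (A^t* *m A).

Lemma frobE n (A : 'M[C]_n) : frob A = \sum_i \sum_j `|A j i| ^+ 2.
Proof.
apply: eq_bigr => i _; rewrite mxE; apply: eq_bigr => j _.
by rewrite !mxE normCKC.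
Qed.

Lemma frob_ge0 n (A : 'M[C]_n) : 0 <= frob A.
Proof. by rewrite frobE; do 2!(apply: sumr_ge0 => ? _); rewrite exprn_ge0. Qed.

Lemma frob_eq0 n (A : 'M[C]_n) : frob A = 0 -> A = 0.
Proof.
rewrite frobE => /eqP; rewrite psumr_eq0 => [/allP A0|i _]; last first.
  by apply: sumr_ge0 => j _; rewrite exprn_ge0.
apply/matrixP => j i; rewrite mxE.
have := A0 i (mem_index_enum i); rewrite psumr_eq0 => [/allP Ai0|k _]; last first.
  by rewrite exprn_ge0.
by have := Ai0 j (mem_index_enum j); rewrite expf_eq0 /= normr_eq0 => /eqP.
Qed.

(** Membership of [X] in the commutant of the self-adjoint algebra generated by [A]. *)
Definition bicommute n (A X : 'M[C]_n) : Prop :=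
  A *m X = X *m A /\ A^t* *m X = X *m A^t*.

Section Normal.
Variables (n : nat) (N : 'M[C]_n).
Hypothesis normalN : N \is normalmx.
Implicit Type X : 'M[C]_n.

(** The left side is twice the real part of <X, D X> for a single jump operator. Once expanded, both
    sides are combinations of traces of words in [N], [X] and their adjoints; cyclicity of the trace
    and normality match the words. *)
Lemma dissipation X :
  \tr (X^t* *m (N *m X *m N^t*
        - 2^-1 *: (N^t* *m N *m X + X *m (N^t* *m N)))) +
  \tr ((N *m X *m N^t*
        - 2^-1 *: (N^t* *m N *m X + X *m (N^t* *m N)))^t* *m X)
  = - frob (N *m X - X *m N).
Proof.
have /normalmxP NN := normalN.
have two : (2^-1 : C)^* = 2^-1 by rewrite fmorphV rmorph_nat.
rewrite /frob !(adjmxD, adjmxN, adjmxZ, adjmxM, trmxCK) two.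
(* The adjoints become independent matrices, tied only by [N *m M = M *m N]. *)
move: (N^t*) (X^t*) NN => M Y NM.
rewrite !(mulmxBl, mulmxBr) -!(scalemxAr, scalemxAl) !(mulmxDl, mulmxDr).
rewrite !(mxtraceB, mxtraceZ, mxtraceD) !mulmxA.
rewrite (mxtrace_mulC (M *m Y *m X) N) !mulmxA NM.
rewrite (mxtrace_mulC (M *m Y *m N) X) !mulmxA.
have -> : \tr (X *m M *m Y *m N) = \tr (Y *m N *m X *m M).
  by rewrite -(mulmxA _ Y N) mxtrace_mulC !mulmxA.
have -> : \tr (Y *m X *m M *m N) = \tr (M *m N *m Y *m X).
  by rewrite -(mulmxA _ M N) mxtrace_mulC !mulmxA.
have -> : \tr (Y *m M *m X *m N) = \tr (N *m Y *m M *m X).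
  by rewrite mxtrace_mulC !mulmxA.
by field.
Qed.

(** For normal [N], the commutators of [X] with [N] and with its adjoint have the same
    Hilbert-Schmidt norm, so they vanish together. *)
Lemma fuglede X : N *m X = X *m N -> bicommute N X.
Proof.
move=> cNX; split=> //; apply/eqP; rewrite -subr_eq0; apply/eqP/frob_eq0.
have : frob (N *m X - X *m N) = 0.
  by rewrite cNX subrr /frob mulmx0 mxtrace0.
have /normalmxP NN := normalN.
rewrite /frob !(adjmxD, adjmxN, adjmxM, trmxCK).
move: (N^t*) (X^t*) NN => M Y NM.
(* The vanishing norm of the first commutator is put in place of 0, so that the goal compares the
   two expanded norms. *)
rewrite !(mulmxBl, mulmxBr) !mxtraceB !mulmxA => <-.
rewrite -(mulmxA Y N M) NM !mulmxA.
have -> : \tr (M *m Y *m N *m X) = \tr (Y *m N *m X *m M).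
  by rewrite -!(mulmxA M) mxtrace_mulC ?mulmxA.
have -> : \tr (N *m Y *m M *m X) = \tr (Y *m M *m X *m N).
  by rewrite -!(mulmxA N) mxtrace_mulC ?mulmxA.
have -> : \tr (M *m Y *m X *m N) = \tr (N *m Y *m X *m M).
  rewrite -!(mulmxA M) mxtrace_mulC -!(mulmxA N) [RHS]mxtrace_mulC.
  by rewrite -!mulmxA NM.
by rewrite !opprB !addrA; ring.
Qed.

End Normal.
End Adjoint.

(** * Explicit indices and finite sums for two qubits *)

(** With closed ordinals the entries of [mx4] matrices reduce by simplification. *)
Definition q00 : 'I_(2 * 2) := @Ordinal (2 * 2) 0 isT.
Definition q01 : 'I_(2 * 2) := @Ordinal (2 * 2) 1 isT.
Definition q10 : 'I_(2 * 2) := @Ordinal (2 * 2) 2 isT.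
Definition q11 : 'I_(2 * 2) := @Ordinal (2 * 2) 3 isT.

Lemma ord4_ind (P : 'I_(2 * 2) -> Prop) :
  P q00 -> P q01 -> P q10 -> P q11 -> forall i, P i.
Proof.
by move=> P0 P1 P2 P3 [[|[|[|[|k]]]] Hk] //; rewrite (bool_irrelevance Hk isT).
Qed.

Lemma sum4E (V : nmodType) (F : 'I_(2 * 2) -> V) :
  \sum_i F i = F q00 + (F q01 + (F q10 + F q11)).
Proof.
(* [big_ord_recl] wants a successor as bound: the sum is unfolded over ['I_4], which is convertible
   to ['I_(2 * 2)]. *)
have sumE (G : 'I_4 -> V) : \sum_i G i =
    G ord0 + (G (lift ord0 ord0) + (G (lift ord0 (lift ord0 ord0)) +
     G (lift ord0 (lift ord0 (lift ord0 ord0))))).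
  by rewrite !big_ord_recl big_ord0 addr0.
rewrite [LHS](sumE F); congr (F _ + (F _ + (F _ + F _))); exact: val_inj.
Qed.

Lemma sum2E (V : nmodType) (F : 'I_2 -> V) : \sum_i F i = F 0 + F 1.
Proof. by rewrite !big_ord_recl big_ord0 addr0; congr (F _ + F _); exact: val_inj. Qed.

Lemma mxtens_indexE :
  [/\ mxtens_index (0 : 'I_2, 0 : 'I_2) = q00,
      mxtens_index (0 : 'I_2, 1 : 'I_2) = q01,
      mxtens_index (1 : 'I_2, 0 : 'I_2) = q10 &
      mxtens_index (1 : 'I_2, 1 : 'I_2) = q11].
Proof. by split; apply: val_inj. Qed.

Lemma ord2_ind (P : 'I_2 -> Prop) : P 0 -> P 1 -> forall i, P i.
Proof.
move=> P0 P1 [[|[|k]] Hk] //.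
  by rewrite (_ : Ordinal Hk = 0) //; apply: val_inj.
by rewrite (_ : Ordinal Hk = 1) //; apply: val_inj.
Qed.

Lemma span4P (K : fieldType) (V : vectType K) (a b c d v : V) :
  reflect (exists x1 x2 x3 x4, v = x1 *: a + (x2 *: b + (x3 *: c + x4 *: d)))
          (v \in <<[:: a; b; c; d]>>%VS).
Proof.
apply: (iffP idP) => [|[x1 [x2 [x3 [x4 ->]]]]].
  rewrite !span_cons span_nil addv0.
  move=> /memv_addP[_ /vlineP[x1 ->] [_ /memv_addP[_ /vlineP[x2 ->]
    [_ /memv_addP[_ /vlineP[x3 ->] [_ /vlineP[x4 ->] ->]] ->]] ->]].
  by exists x1, x2, x3, x4.
by rewrite !rpredD // rpredZ // memv_span // !inE eqxx ?orbT.
Qed.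

(** * Coordinates on X_DeltaE, partial traces and the Hamiltonian *)

Section TwoQubits.
Variable R : realType.
Local Notation C := R[i].
Local Notation op := 'M[C]_(2 * 2).

Lemma mx4P (A B : op) :
  (forall i j, A i j = B i j) <-> A = B.
Proof. by split=> [?|->//]; apply/matrixP. Qed.

(** The operator [x1 |00><01| + x2 |00><10| + x3 |01><11| + x4 |10><11|]. *)
Definition raise (x1 x2 x3 x4 : C) : op := mx4
  [:: [:: 0; x1; x2; 0]; [:: 0; 0; 0; x3]; [:: 0; 0; 0; x4]; [:: 0; 0; 0; 0]].

Lemma mul_raise (A : op) x1 x2 x3 x4 : A *m raise x1 x2 x3 x4 = \matrix_(i, j)
  [:: 0; A i q00 * x1; A i q00 * x2; A i q01 * x3 + A i q10 * x4]`_j.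
Proof.
by apply/mx4P => i; elim/ord4_ind; rewrite !mxE sum4E !mxE /= ?(mulr0, add0r, addr0).
Qed.

Lemma raise_mul (A : op) x1 x2 x3 x4 : raise x1 x2 x3 x4 *m A = \matrix_(i, j)
  [:: x1 * A q01 j + x2 * A q10 j; x3 * A q11 j; x4 * A q11 j; 0]`_i.
Proof.
by apply/mx4P; elim/ord4_ind => j; rewrite !mxE sum4E !mxE /= ?(mul0r, add0r, addr0).
Qed.

Lemma ketbraE i j k l :
  ketbra R i j k l = delta_mx (mxtens_index (i, j)) (mxtens_index (k, l)).
Proof.
apply/matrixP => a b; case: (mxtens_indexP a) => a1 a2.
case: (mxtens_indexP b) => b1 b2.
have ketE i' j' k' l' z : ket R i' j' (mxtens_index (k', l')) z =
    ((k' == i') && (l' == j'))%:R.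
  have eq0T (y : 'I_1) : (y == 0) = true by rewrite ord1.
  by rewrite !mxE mxtens_indexK /= !eq0T !andbT -natrM mulnb.
rewrite /ketbra mxE big_ord1 ketE [map_mx _ _ _ _]mxE [trmx _ _ _]mxE ketE.
by rewrite rmorph_nat -natrM mulnb mxE !(can_eq (@mxtens_indexK _ _)).
Qed.

Lemma X_DeltaEP (X : op) :
  reflect (exists x1 x2 x3 x4, X = raise x1 x2 x3 x4) (X \in X_DeltaE R).
Proof.
have [e00 e01 e10 e11] := mxtens_indexE.
have raiseE x1 x2 x3 x4 : raise x1 x2 x3 x4 =
    x1 *: ketbra R 0 0 0 1 + (x2 *: ketbra R 0 0 1 0 +
      (x3 *: ketbra R 0 1 1 1 + x4 *: ketbra R 1 0 1 1)).
  rewrite !ketbraE e00 e01 e10 e11.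
  by apply/mx4P; elim/ord4_ind; elim/ord4_ind;
     rewrite !mxE /= ?(mulr0, mulr1, addr0, add0r).
apply: (iffP (span4P _ _ _ _ _)) => -[x1 [x2 [x3 [x4 ->]]]];
  by exists x1, x2, x3, x4; rewrite raiseE.
Qed.

Lemma trA_raise x1 x2 x3 x4 :
  trA (raise x1 x2 x3 x4) = (x1 + x4) *: delta_mx 0 1.
Proof.
have [e00 e01 e10 e11] := mxtens_indexE.
by apply/matrixP; elim/ord2_ind; elim/ord2_ind;
  rewrite !mxE sum2E /= ?(e00, e01, e10, e11) !mxE /= ?(mulr0, mulr1, addr0).
Qed.

Lemma trB_raise x1 x2 x3 x4 :
  trB (raise x1 x2 x3 x4) = (x2 + x3) *: delta_mx 0 1.
Proof.
have [e00 e01 e10 e11] := mxtens_indexE.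
by apply/matrixP; elim/ord2_ind; elim/ord2_ind;
  rewrite !mxE sum2E /= ?(e00, e01, e10, e11) !mxE /= ?(mulr0, mulr1, addr0).
Qed.

Lemma hamiltonianE E0 E1 : hamiltonian E0 E1 = @mx4 R
  [:: [:: E0%:C + E0%:C; 0; 0; 0]; [:: 0; E0%:C + E1%:C; 0; 0];
      [:: 0; 0; E0%:C + E1%:C; 0]; [:: 0; 0; 0; E1%:C + E1%:C]].
Proof.
apply/mx4P; elim/ord4_ind; elim/ord4_ind;
  by rewrite !mxE /= ?(mulr0, mulr1, mulr0n, mulr1n, addr0, mul0r, mul1r) // addrC.
Qed.

(** All four matrix units in [raise] join two levels whose energies differ by [E0 - E1]. *)
Lemma hamiltonian_raise E0 E1 x1 x2 x3 x4 :
  hamiltonian E0 E1 *m raise x1 x2 x3 x4 - raise x1 x2 x3 x4 *m hamiltonian E0 E1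
  = (E0 - E1)%:C *: raise x1 x2 x3 x4.
Proof.
rewrite mul_raise raise_mul hamiltonianE rmorphB /=.
by apply/mx4P; elim/ord4_ind; elim/ord4_ind; rewrite !mxE /=; ring.
Qed.

End TwoQubits.

(** * Eigenspaces and their finite sums *)

Section VectorSpaces.
Variables (K : fieldType) (V : vectType K).

Lemma leigenspaceP (f : {linear V -> V}) (a : K) (v : V) :
  reflect (f v = a *: v) (v \in passmx.leigenspace (linfun f) a).
Proof. by rewrite memv_ker !lfun_simp subr_eq0; apply: eqP. Qed.

(** Carries a property closed under addition from the eigenspaces to the attractor space, without
    building the subspace that the property defines. *)
Lemma memv_sum_ind (I : eqType) (s : seq I) (U : I -> {vspace V}) (P : V -> Prop) :
  P 0 -> (forall u v, P u -> P v -> P (u + v)) ->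
  (forall i u, i \in s -> u \in U i -> P u) ->
  forall v, v \in (\sum_(i <- s) U i)%VS -> P v.
Proof.
move=> P0 PD; elim: s => [|i s IHs] PU v.
  by rewrite big_nil memv0 => /eqP->.
rewrite big_cons => /memv_addP[u uUi [w ws ->]].
apply: PD; first by apply: PU uUi; rewrite mem_head.
by apply: IHs ws => k u' ks; apply: PU; rewrite inE ks orbT.
Qed.

End VectorSpaces.

(** * Attractors in X_DeltaE as the operators commuting with all jump operators *)

Section Attractor.
Local Open Scope sesquilinear_scope.
Variable R : realType.
Local Notation C := R[i].
Local Notation op := 'M[C]_(2 * 2).

Lemma conj_complex (x y : R) : Num.conj (x +i* y) = x -i* y.
Proof. by []. Qed.

Lemma conj_real (x : R) : Num.conj x%:C = x%:C.
Proof. by rewrite conj_complex oppr0. Qed.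

Lemma hamiltonian_hermitian (E0 E1 : R) : (hamiltonian E0 E1)^t* = hamiltonian E0 E1.
Proof.
rewrite hamiltonianE.
by apply/mx4P; elim/ord4_ind; elim/ord4_ind;
   rewrite !mxE /= ?rmorph0 // rmorphD /= ?conj_real.
Qed.

(** The map X to -i[H, X] is skew-adjoint for the trace inner product, so the Hamiltonian
    contributes nothing to the dissipation. *)
Lemma commutator_skew n (H X : 'M[C]_n) : H^t* = H ->
  \tr (X^t* *m - ('i%R *: (H *m X - X *m H))) +
  \tr ((- ('i%R *: (H *m X - X *m H)))^t* *m X) = 0.
Proof.
move=> HH; rewrite !(adjmxD, adjmxN, adjmxZ, adjmxM) HH conjCi.
rewrite !(mulmxN, mulNmx, raddfN) /= -!(scalemxAr, scalemxAl) !mxtraceZ.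
rewrite !(mulmxBr, mulmxBl) !mxtraceB ?mulmxA.
rewrite -(mulmxA H) (mxtrace_mulC H) ?mulmxA.
by ring.
Qed.

Variables (E0 E1 : R) (n : nat) (L : 'I_n -> op).
Hypothesis normalL : forall j, L j \is normalmx.

Lemma generator_dissipation (X : op) :
  \tr (X^t* *m generator E0 E1 L X) + \tr ((generator E0 E1 L X)^t* *m X)
  = - \sum_j frob (L j *m X - X *m L j).
Proof.
rewrite /generator; set U := - _; set D := \sum_j _.
rewrite adjmxD mulmxDl mulmxDr !mxtraceD addrACA.
rewrite commutator_skew ?hamiltonian_hermitian // add0r.
rewrite /D adjmx_sum mulmx_sumr mulmx_suml !(raddf_sum mxtrace) -big_split -sumrN.
by apply: eq_bigr => j _; apply: dissipation.
Qed.

(** On an eigenvector the left side of [generator_dissipation] is twice the real part of [lambda]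
    times [frob X], hence 0; a vanishing sum of nonnegative norms has vanishing terms. *)
Lemma imaginary_eigenvector_commutes (lambda : C) (X : op) :
  'Re lambda = 0 -> generator E0 E1 L X = lambda *: X ->
  forall j, L j *m X = X *m L j.
Proof.
move=> re0 eigX.
have := generator_dissipation X; rewrite eigX adjmxZ -scalemxAr -scalemxAl !mxtraceZ.
rewrite -mulrDl; have -> : lambda + lambda^* = 0.
  by move: re0; rewrite ReE => /eqP; rewrite mulf_eq0 invr_eq0 pnatr_eq0 orbF => /eqP.
rewrite mul0r => /esym/eqP; rewrite oppr_eq0 psumr_eq0 => [/allP sum0 j|j _]; last first.
  exact: frob_ge0.
apply/eqP; rewrite -subr_eq0; apply/eqP/frob_eq0/eqP.
exact: sum0 j (mem_index_enum j).
Qed.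

Lemma attractor_commutes (X : op) :
  attractor E0 E1 L X -> forall j, L j *m X = X *m L j.
Proof.
move=> [s [_ s_im sX]]; 
apply: (memv_sum_ind (P := fun X => forall j, L j *m X = X *m L j) _ _ _ sX)
  => {X sX} [j|X Y cX cY j|lambda X s_lambda].
- by rewrite mulmx0 mul0mx.
- by rewrite mulmxDl mulmxDr cX cY.
have [_ re0] := s_im lambda s_lambda.
by move=> /leigenspaceP; apply: imaginary_eigenvector_commutes.
Qed.

(** By Fuglede [X] also commutes with the adjoints, so [X] factors out of each dissipator term, and
    normality makes what remains cancel. Only the commutator with the Hamiltonian is left. *)
Lemma generator_raise x1 x2 x3 x4 (X := raise x1 x2 x3 x4) :
  (forall j, L j *m X = X *m L j) ->
  generator E0 E1 L X = (- ('i%R * (E0 - E1)%:C)) *: X.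
Proof.
move=> cLX; rewrite /generator hamiltonian_raise scalerA scaleNr.
rewrite big1 ?addr0 // => j _.
have /normalmxP NN := normalL j; have [cX cX'] := fuglede (normalL j) (cLX j).
rewrite -(mulmxA _ (L j) X) cX !mulmxA cX' -!mulmxA NN.
by apply/mx4P => a b; rewrite !mxE; field.
Qed.

Lemma attractor_raise x1 x2 x3 x4 (X := raise x1 x2 x3 x4) :
  attractor E0 E1 L X <-> forall j, L j *m X = X *m L j.
Proof.
split=> [|/generator_raise eigX]; first exact: attractor_commutes.
(* The zero operator does not certify that [lambda] is an eigenvalue, so it gets the empty list. *)
have [->|X0] := eqVneq X 0.
  by exists [::]; split=> //; rewrite big_nil mem0v.
set lambda := - _ in eigX.
have Xlambda : X \in passmx.leigenspace (linfun (generator E0 E1 L)) lambda.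
  exact/leigenspaceP.
exists [:: lambda]; split=> // [z|]; last by rewrite big_seq1.
rewrite inE => /eqP->; split.
  by apply: contraNneq X0 => V0; move: Xlambda; rewrite V0 memv0.
by rewrite ReE /lambda rmorphN rmorphM /= conjCi conj_real mulNr opprK addNr mul0r.
Qed.

End Attractor.

(** * Unimodular numbers and normal 2 by 2 blocks *)

Section UnitComplex.
Variable R : realType.
Local Notation C := R[i].

Lemma expiD (x y : R) : expi (x + y) = expi x * expi y :> C.
Proof. by rewrite /expi cosD sinD [sin x * _ + _]addrC. Qed.

Lemma expi0 : expi 0 = 1 :> C.
Proof. by rewrite /expi cos0 sin0. Qed.

Lemma conj_expi (x : R) : Num.conj (expi x : C) = expi (- x).
Proof. by rewrite conj_complex /expi cosN sinN. Qed.

Lemma expiNM (x : R) : expi (- x) * expi x = 1 :> C.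
Proof. by rewrite -expiD addNr expi0. Qed.

Lemma expi_neq0 (x : R) : expi x != 0 :> C.
Proof. by apply/eqP => e0; have /eqP := expiNM x; rewrite e0 mulr0 eq_sym oner_eq0. Qed.

Lemma expiE (x : R) : expi x = (cos x)%:C + 'i%R * (sin x)%:C :> C.
Proof. by rewrite -complexiE /expi [LHS]complexE. Qed.

Lemma cos2Dsin2C (x : R) : (cos x)%:C ^+ 2 + (sin x)%:C ^+ 2 = 1 :> C.
Proof. by rewrite -!rmorphXn -rmorphD cos2Dsin2. Qed.

(** [acos] of the real part has the right cosine, and the right sine up to sign; the sign of the
    imaginary part selects the angle or its opposite. *)
Lemma expi_surj (z : C) : z * Num.conj z = 1 -> exists x : R, z = expi x.
Proof.
case: z => a b; rewrite conj_complex => -[].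
rewrite mulrN opprK => ab1 _.
have a_itv : -1 <= a <= 1 by nra.
have cosa : cos (acos a) = a by rewrite acosK // in_itv.
have sina : sin (acos a) = `|b|.
  by rewrite sin_acos // -sqrtr_sqr; congr Num.sqrt; rewrite -ab1; ring.
case: (lerP 0 b) => b0; [exists (acos a)|exists (- acos a)]; rewrite /expi.
  by rewrite cosa sina ger0_norm.
by rewrite cosN sinN cosa sina ltr0_norm // opprK.
Qed.

Lemma conj_fixed_real (z : C) : Num.conj z = z -> exists m : R, z = m%:C.
Proof.
case: z => a b; rewrite conj_complex => -[] b0; exists a.
by congr (_ +i* _); lra.
Qed.

Lemma polar (z : C) : exists m k : R, z = m%:C * expi k.
Proof.
have [->|z0] := eqVneq z 0; first by exists 0, 0; rewrite mul0r.
have nz0 : `|z| != 0 by rewrite normr_eq0.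
have [m m_z] : exists m : R, `|z| = m%:C.
  by apply: conj_fixed_real; apply/CrealP; apply: normr_real.
have [k k_z] : exists k, z / `|z| = expi k.
  apply: expi_surj; rewrite rmorphM fmorphV /= (CrealP (normr_real z)).
  by rewrite mulrACA -normCK -invfM -expr2 divff // expf_neq0.
by exists m, k; rewrite -m_z -k_z mulrC divfK.
Qed.

(** The hypotheses are two entries of the normality equation of the matrix with rows (a, b) and (b',
    d). The first gives equal moduli to [b] and [b']. If both vanish, [m] and [k] come from the
    polar form of [d - a]. *)
Lemma normal_block (a b b' d : C) :
  b * Num.conj b = Num.conj b' * b' ->
  a * Num.conj b' + b * Num.conj d = Num.conj a * b + Num.conj b' * d ->
  exists k m : R, b' = expi (2 * k) * Num.conj b /\ d = a + m%:C * expi k.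
Proof.
move=> bb abd; have [b0|b0] := eqVneq b 0.
  have b'0 : b' = 0.
    apply/eqP; rewrite -[_ == 0]orbb -{1}conjC_eq0 -mulf_eq0 -bb b0 mul0r //.
  have [m [k dE]] := polar (d - a).
  by exists k, m; rewrite b0 b'0 rmorph0 mulr0 -dE addrC subrK.
have cb0 : Num.conj b != 0 by rewrite conjC_eq0.
have [x xE] : exists x, b' / Num.conj b = expi x.
  apply: expi_surj; rewrite rmorphM fmorphV /= conjCK mulrACA -invfM.
  by rewrite [b' * _]mulrC -bb [Num.conj b * _]mulrC divff // mulf_neq0.
have b'E : b' = expi x * Num.conj b by rewrite -xE divfK.
(* The second hypothesis now says that conj(d - a) = e^(-ix) (d - a), so half the angle [x] makes (d
   - a) e^(-ik) real. *)
pose k := x / 2; have xk : x = 2 * k by rewrite /k; field.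
have [m mE] : exists m, (d - a) * expi (- k) = m%:C.
  apply: conj_fixed_real; rewrite rmorphM rmorphB /= conj_expi opprK.
  have e2 : expi (- x) = expi (- k) * expi (- k) :> C.
    by rewrite -expiD; congr expi; rewrite /k; field.
  have := expiNM k; move: abd; rewrite b'E rmorphM /= conj_expi conjCK e2 => abd ek.
  apply: (mulIf b0); rewrite (_ : (Num.conj d - Num.conj a) * expi k * b =
    (b * Num.conj d - Num.conj a * b) * expi k); last by ring.
  have -> : b * Num.conj d - Num.conj a * b = (d - a) * (expi (- k) * expi (- k) * b).
    apply/eqP; rewrite -subr_eq0; apply/eqP; move/eqP: abd; rewrite -subr_eq0 => /eqP <-.
    by ring.
  transitivity ((d - a) * expi (- k) * b * (expi (- k) * expi k)); first by ring.
  by rewrite ek mulr1; ring.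
exists k, m; rewrite -xk b'E; split=> //.
by rewrite -mE -mulrA expiNM mulr1 addrC subrK.
Qed.

End UnitComplex.

(** * Unitary changes of basis *)

Section BasisChange.
Local Open Scope sesquilinear_scope.
Local Open Scope ring_scope.

Lemma bicommute_adj (F : numClosedFieldType) n (A X : 'M[F]_n) :
  bicommute A X -> A *m X^t* = X^t* *m A.
Proof.
move=> [_ cAX]; have := congr1 (fun M : 'M[F]_n => M^t*) cAX.
by rewrite !adjmxM !trmxCK.
Qed.

Lemma unitary_conj_commute (F : numClosedFieldType) n (T A X : 'M[F]_n) :
  T \is unitarymx ->
  (T *m A *m T^t*) *m (T *m X *m T^t*) = (T *m X *m T^t*) *m (T *m A *m T^t*)
  <-> A *m X = X *m A.
Proof.
move=> uT; have TT : T^t* *m T = 1%:M.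
  by move: uT; rewrite -trmxC_unitary => /unitarymxP; rewrite trmxCK.
have mulE B Y : (T *m B *m T^t*) *m (T *m Y *m T^t*) = T *m (B *m Y) *m T^t*.
  by rewrite !mulmxA -(mulmxA _ (T^t*) T) TT mulmx1.
rewrite !mulE; split=> [|->//] /(congr1 (fun M => T^t* *m M *m T)).
by rewrite !mulmxA TT !mul1mx -!mulmxA TT !mulmx1.
Qed.

Lemma unitary_conjK (F : numClosedFieldType) n (T A : 'M[F]_n) :
  T \is unitarymx -> T *m (T^t* *m A *m T) *m T^t* = A.
Proof.
by move=> /unitarymxP TT; rewrite !mulmxA TT mul1mx -mulmxA TT mulmx1.
Qed.

Lemma unitary_conj_normal (F : numClosedFieldType) n (T A : 'M[F]_n) :
  T \is unitarymx -> A \is normalmx -> T *m A *m T^t* \is normalmx.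
Proof.
move=> uT /normalmxP AA; apply/normalmxP.
have TT : T^t* *m T = 1%:M.
  by move: uT; rewrite -trmxC_unitary => /unitarymxP; rewrite trmxCK.
rewrite !adjmxM trmxCK !mulmxA -!(mulmxA _ (T^t*) T) TT !mulmx1.
by rewrite -(mulmxA T) AA mulmxA.
Qed.

Variable R : realType.
Local Notation C := R[i].
Local Notation op := 'M[C]_(2 * 2).

(** The common shape of [T1], [T2] and [Ttheta]. *)
Definition mid (p q r s : C) : op := mx4
  [:: [:: 1; 0; 0; 0]; [:: 0; p; q; 0]; [:: 0; r; s; 0]; [:: 0; 0; 0; 1]].

Lemma mid_adj p q r s : (mid p q r s)^t* = mid p^* r^* q^* s^*.
Proof.
by apply/mx4P; elim/ord4_ind; elim/ord4_ind; rewrite !mxE /= ?rmorph0 ?rmorph1.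
Qed.

Lemma mid_unitary p q r s :
  p * p^* + q * q^* = 1 -> r * r^* + s * s^* = 1 -> p * r^* + q * s^* = 0 ->
  mid p q r s \is unitarymx.
Proof.
move=> pq rs pr; have rp : r * p^* + s * q^* = 0.
  by rewrite -[LHS]conjCK rmorphD !rmorphM /= !conjCK ![_^* * _]mulrC pr rmorph0.
apply/unitarymxP; rewrite mid_adj.
by apply/mx4P; elim/ord4_ind; elim/ord4_ind;
  rewrite !mxE !sum4E !mxE /= ?(mul0r, mulr0, add0r, addr0, mulr1).
Qed.

(** A unitary mixing only |01> and |10> preserves X_DeltaE: it acts on the ket coordinates by its
    middle block and on the bra coordinates by the conjugate block. *)
Lemma mid_raise p q r s y1 y2 y3 y4 :
  mid p q r s *m raise y1 y2 y3 y4 *m (mid p q r s)^t* =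
  raise (y1 * p^* + y2 * q^*) (y1 * r^* + y2 * s^*)
        (p * y3 + q * y4) (r * y3 + s * y4).
Proof.
rewrite mid_adj mul_raise.
by apply/mx4P; elim/ord4_ind; elim/ord4_ind;
  rewrite !mxE sum4E !mxE /= ?(mul0r, mulr0, add0r, addr0, mulr1, mul1r).
Qed.

End BasisChange.

(** * Phase-locking as a linear condition on the commutant *)

Section Locking.
Local Open Scope sesquilinear_scope.
Local Open Scope ring_scope.
Variable R : realType.
Local Notation C := R[i].
Local Notation op := 'M[C]_(2 * 2).

Section PhaseLockingE.
Variables (E0 E1 : R) (n : nat) (L : 'I_n -> op) (phi : R).
Hypothesis normalL : forall j, L j \is normalmx.

(** Both partial traces of a [raise] are multiples of |0><1|, so locking compares two scalars, and
    [attractor_raise] replaces attractors by commuting operators. *)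
Lemma phase_lockingE : phase_locking E0 E1 L phi <->
  (forall x1 x2 x3 x4,
     (forall j, L j *m raise x1 x2 x3 x4 = raise x1 x2 x3 x4 *m L j) ->
     x1 + x4 = expi phi * (x2 + x3)) /\
  (exists x1 x2 x3 x4,
     (forall j, L j *m raise x1 x2 x3 x4 = raise x1 x2 x3 x4 *m L j) /\
     x2 + x3 != 0).
Proof.
have scale01 (z t : C) :
    z *: delta_mx 0 1 = t *: (delta_mx 0 1 : 'M[C]_2) <-> z = t.
  split=> [/matrixP/(_ 0 1)|->//]; by rewrite !mxE /= !mulr1.
split=> [[lock [X [attX /X_DeltaEP[x1 [x2 [x3 [x4 XE]]]] trX]]]|[lock ex]].
  split=> [z1 z2 z3 z4 /(attractor_raise E0 E1 normalL) attz|].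
    have /(lock _ attz) : raise z1 z2 z3 z4 \in X_DeltaE R.
      by apply/X_DeltaEP; exists z1, z2, z3, z4.
    by rewrite trA_raise trB_raise scalerA => /scale01.
  exists x1, x2, x3, x4; split.
    by apply/(attractor_raise E0 E1 normalL); rewrite -XE.
  by apply: contraNneq trX => x0; rewrite XE trB_raise x0 scale0r.
split=> [X attX /X_DeltaEP[x1 [x2 [x3 [x4 XE]]]]|].
  rewrite XE trA_raise trB_raise scalerA; apply/scale01/lock.
  by apply/(attractor_raise E0 E1 normalL); rewrite -XE.
have [x1 [x2 [x3 [x4 [comm x0]]]]] := ex.
exists (raise x1 x2 x3 x4); split.
- exact/(attractor_raise E0 E1 normalL).
- by apply/X_DeltaEP; exists x1, x2, x3, x4.
rewrite trB_raise; apply: contraNneq x0 => eq0.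
by apply/eqP/scale01; rewrite eq0 scale0r.
Qed.

(** Transports the criterion to a basis where the jump operators have block form; the nonzero
    factors [u j] leave the commutant unchanged. *)
Lemma phase_locking_basis (p q r s : C) (u : 'I_n -> C) (B : 'I_n -> op) :
  mid p q r s \is unitarymx -> (forall j, u j != 0) ->
  (forall j, u j *: L j = mid p q r s *m B j *m (mid p q r s)^t*) ->
  phase_locking E0 E1 L phi <->
  (forall y1 y2 y3 y4,
     (forall j, B j *m raise y1 y2 y3 y4 = raise y1 y2 y3 y4 *m B j) ->
     (y1 * p^* + y2 * q^*) + (r * y3 + s * y4) =
     expi phi * ((y1 * r^* + y2 * s^*) + (p * y3 + q * y4))) /\
  (exists y1 y2 y3 y4,
     (forall j, B j *m raise y1 y2 y3 y4 = raise y1 y2 y3 y4 *m B j) /\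
     (y1 * r^* + y2 * s^*) + (p * y3 + q * y4) != 0).
Proof.
move=> uT u0 LB.
have commE y1 y2 y3 y4 :
    (forall j, L j *m raise (y1 * p^* + y2 * q^*) (y1 * r^* + y2 * s^*)
        (p * y3 + q * y4) (r * y3 + s * y4) =
      raise (y1 * p^* + y2 * q^*) (y1 * r^* + y2 * s^*)
        (p * y3 + q * y4) (r * y3 + s * y4) *m L j) <->
    (forall j, B j *m raise y1 y2 y3 y4 = raise y1 y2 y3 y4 *m B j).
  rewrite -mid_raise; split=> comm j.
    apply/(unitary_conj_commute _ _ uT).
    by rewrite -LB -scalemxAl comm scalemxAr.
  apply: (scalerI (u0 j)); rewrite scalemxAl scalemxAr LB.
  exact/(unitary_conj_commute _ _ uT).
have surj x1 x2 x3 x4 : exists y1 y2 y3 y4,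
    [/\ x1 = y1 * p^* + y2 * q^*, x2 = y1 * r^* + y2 * s^*,
        x3 = p * y3 + q * y4 & x4 = r * y3 + s * y4].
  (* The adjoint of a [mid] is again a [mid], so the same formula computes the inverse conjugation,
     whose coordinates are the wanted preimage. *)
  have := mid_raise p^* r^* q^* s^* x1 x2 x3 x4; rewrite -!mid_adj trmxCK => down.
  have := unitary_conjK (raise x1 x2 x3 x4) uT; rewrite down mid_raise.
  set y1 := x1 * _ + _; set y2 := x1 * _ + _; set y3 := p^* * x3 + _; set y4 := q^* * x3 + _ => raiseE.
  exists y1, y2, y3, y4.
  have entry i j := congr1 (fun M : op => M i j) raiseE.
  have := (entry q00 q01, entry q00 q10, entry q01 q11, entry q10 q11).
  by rewrite !mxE /= => -[[[-> ->] ->] ->].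
rewrite phase_lockingE; split=> -[lock ex]; split.
- by move=> y1 y2 y3 y4 /commE; apply: lock.
- have [x1 [x2 [x3 [x4 [comm x0]]]]] := ex.
  have [y1 [y2 [y3 [y4 [e1 e2 e3 e4]]]]] := surj x1 x2 x3 x4.
  exists y1, y2, y3, y4; split; last by rewrite -e2 -e3.
  by apply/commE; rewrite -e1 -e2 -e3 -e4.
- move=> y1 y2 y3 y4; have [z1 [z2 [z3 [z4 [-> -> -> ->]]]]] := surj y1 y2 y3 y4.
  by move=> /commE; apply: lock.
have [y1 [y2 [y3 [y4 [comm y0]]]]] := ex.
by do 4!eexists; split; [apply/commE; exact: comm | exact: y0].
Qed.

End PhaseLockingE.

Implicit Types (a b c d w : C) (A X : op).

(** [block1], [block2], [block3] are the middle factors of the operators in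
    [S1], [S2], [Stheta], before normality relates [b'] and [d] to [a] and [b]. *)
Definition block1 c a b b' d : op := mx4
  [:: [:: c; 0; 0; 0]; [:: 0; c; 0; 0]; [:: 0; 0; a; b]; [:: 0; 0; b'; d]].

Definition block2 a b b' d c : op := mx4
  [:: [:: a; b; 0; 0]; [:: b'; d; 0; 0]; [:: 0; 0; c; 0]; [:: 0; 0; 0; c]].

Definition block3 w a b b' d : op := mx4
  [:: [:: a; b; 0; 0]; [:: b'; d; 0; 0]; [:: 0; 0; a; w * b]; [:: 0; 0; w^* * b'; d]].

(** An equality of propositions, so that it can rewrite inside conjunctions. *)
Lemma mulrB_eq0 (x a b : C) : (x * (a - b) = 0) = (a * x = b * x).
Proof.
apply: propext; rewrite mulrBr ![x * _]mulrC; split=> [/eqP|->]; last by rewrite subrr.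
by rewrite subr_eq0 => /eqP.
Qed.

(** [y1] stays free because |00><01| acts inside the subspace where [block1] is the scalar [c]. In
    [block2_raise] it is [y4] that stays free. *)
Lemma block1_raise c a b b' d y1 y2 y3 y4 (X := raise y1 y2 y3 y4) :
  block1 c a b b' d *m X = X *m block1 c a b b' d <->
  [/\ y2 * (a - c) = 0, y2 * b = 0, y3 * (d - c) = 0, y3 * b' = 0 &
      y4 * (a - d) = 0 /\ y4 * b' = 0].
Proof.
rewrite !mulrB_eq0 mul_raise raise_mul -mx4P; split=> [e|[e1 e2 e3 e4 [e5 e6]]].
  have := (e q00 q10, e q00 q11, e q01 q11, e q01 q10, (e q10 q11, e q11 q11)).
  rewrite !mxE /= ?(mul0r, mulr0, add0r, addr0).
  move=> [[[[h1 h2] h3] h4] [h5 h6]].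
  by rewrite h1 h3 h5 -h2 -h4 ![_ * y2]mulrC ![_ * y3]mulrC ![_ * y4]mulrC [y4 * b']mulrC h6.
elim/ord4_ind; elim/ord4_ind;
  rewrite !mxE /= ?(mul0r, mulr0, add0r, addr0) // ?e2 ?e4 ?e6 //.
all: try by rewrite mulrC.
all: by rewrite [RHS]mulrC ?e1 ?e3 ?e5.
Qed.

Lemma block2_raise a b b' d c y1 y2 y3 y4 (X := raise y1 y2 y3 y4) :
  block2 a b b' d c *m X = X *m block2 a b b' d c <->
  [/\ y1 * (a - d) = 0, y1 * b' = 0, y2 * (a - c) = 0, y2 * b' = 0 &
      y3 * (d - c) = 0 /\ y3 * b = 0].
Proof.
rewrite !mulrB_eq0 mul_raise raise_mul -mx4P; split=> [e|[e1 e2 e3 e4 [e5 e6]]].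
  have := (e q00 q01, e q00 q00, e q00 q10, e q01 q10, (e q01 q11, e q00 q11)).
  rewrite !mxE /= ?(mul0r, mulr0, add0r, addr0).
  move=> [[[[h1 h2] h3] h4] [h5 h6]].
  by rewrite h1 h3 h5 -h2 ![_ * y1]mulrC ![_ * y2]mulrC ![_ * y3]mulrC [y2 * b']mulrC h4 [y3 * b]mulrC h6.
elim/ord4_ind; elim/ord4_ind;
  rewrite !mxE /= ?(mul0r, mulr0, add0r, addr0) // ?e2 ?e4 ?e6 //.
all: try by rewrite mulrC.
all: by rewrite [RHS]mulrC ?e1 ?e3 ?e5.
Qed.

(** For |w| = 1 the operator |00><10| + w |01><11| intertwines the two diagonal blocks, so [y2] and
    [y3] are constrained only through [y3 - w * y2]. *)
Lemma block3_raise w a b b' d y1 y2 y3 y4 (X := raise y1 y2 y3 y4) :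
  w * w^* = 1 ->
  block3 w a b b' d *m X = X *m block3 w a b b' d <->
  [/\ y1 * (a - d) = 0, y1 * b' = 0, b * (y3 - w * y2) = 0, b' * (y3 - w * y2) = 0 &
      y4 * (a - d) = 0 /\ y4 * b' = 0].
Proof.
move=> ww.
rewrite !mulrB_eq0 mul_raise raise_mul -mx4P; split=> [e|[e1 e2 e3 e4 [e5 e6]]].
  have := (e q00 q01, e q00 q00, e q00 q11, e q01 q10, (e q10 q11, e q10 q10)).
  rewrite !mxE /= ?(mul0r, mulr0, add0r, addr0).
  move=> [[[[h1 h2] h3] h4] [h5 h6]]; split; [by rewrite h1 mulrC|by []| | |split].
  - by rewrite mulrC h3; ring.
  - transitivity (w * (y3 * (w^* * b'))); last by rewrite -h4; ring.
    by rewrite -[LHS]mul1r -ww; ring.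
  - by rewrite h5 mulrC.
  - transitivity (w * (y4 * (w^* * b'))); last by rewrite -h6 mulr0.
    by rewrite -[LHS]mul1r -ww; ring.
elim/ord4_ind; elim/ord4_ind;
  rewrite !mxE /= ?(mul0r, mulr0, add0r, addr0) // ?e2 ?e6 //.
all: try by rewrite mulrC.
- by rewrite [RHS]mulrC.
- by rewrite mulrC e3; ring.
- transitivity (w^* * (y3 * b')); last by ring.
  by rewrite e4; transitivity (w * w^* * (b' * y2)); [rewrite ww mul1r | ring].
- by rewrite mulrCA e6 mulr0.
- by rewrite [RHS]mulrC.
- by rewrite -mulrA [b' * y4]mulrC e6 mulr0.
Qed.

End Locking.

(** * Block forms forced by commutation and normality *)

Section Structure.
Local Open Scope sesquilinear_scope.
Local Open Scope ring_scope.
Variable R : realType.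
Local Notation C := R[i].
Local Notation op := 'M[C]_(2 * 2).
Implicit Types (a b c d w : C) (A X : op).

Lemma raise_adj x1 x2 x3 x4 : (raise x1 x2 x3 x4)^t* = @mx4 R
  [:: [:: 0; 0; 0; 0]; [:: x1^*; 0; 0; 0]; [:: x2^*; 0; 0; 0]; [:: 0; x3^*; x4^*; 0]].
Proof.
by apply/mx4P; elim/ord4_ind; elim/ord4_ind; rewrite !mxE /= ?rmorph0.
Qed.

Lemma mul_raise_adj A x1 x2 x3 x4 : A *m (raise x1 x2 x3 x4)^t* = \matrix_(i, j)
  [:: A i q01 * x1^* + A i q10 * x2^*; A i q11 * x3^*; A i q11 * x4^*; 0]`_j.
Proof.
rewrite raise_adj; apply/mx4P => i; elim/ord4_ind;
by rewrite !mxE sum4E !mxE /= ?(mulr0, add0r, addr0).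
Qed.

Lemma raise_adj_mul A x1 x2 x3 x4 : (raise x1 x2 x3 x4)^t* *m A = \matrix_(i, j)
  [:: 0; x1^* * A q00 j; x2^* * A q00 j; x3^* * A q01 j + x4^* * A q10 j]`_i.
Proof.
rewrite raise_adj; apply/mx4P; elim/ord4_ind => j;
by rewrite !mxE sum4E !mxE /= ?(mul0r, add0r, addr0).
Qed.

(** Commuting with |00><01| and its adjoint means commuting with their products, the projections on
    |00> and |01>, and having equal diagonal entries there: [A] is scalar on that plane and reduced
    by it. *)
Lemma block1_structure A : bicommute A (raise 1 0 0 0) ->
  A = block1 (A q00 q00) (A q10 q10) (A q10 q11) (A q11 q10) (A q11 q11).
Proof.
move=> cA; have := bicommute_adj cA.
rewrite mul_raise_adj raise_adj_mul ?conjC0 ?conjC1 => /mx4P e'.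
have := cA.1; rewrite mul_raise raise_mul => /mx4P e.
have := (e q00 q00, e q00 q01, e q00 q10, e q00 q11, e q10 q01, e q11 q01).
have := (e' q00 q00, e' q10 q00, e' q11 q00, e' q01 q10, e' q01 q11).
rewrite !mxE /= ?(mul0r, mulr0, add0r, addr0, mul1r, mulr1).
move=> [[[[h1 h2] h3] h4] h5] [[[[[g1 g2] g3] g4] g5] g6].
by apply/mx4P; elim/ord4_ind; elim/ord4_ind; rewrite [RHS]mxE.
Qed.

Lemma block2_structure A : bicommute A (raise 0 0 0 1) ->
  A = block2 (A q00 q00) (A q00 q01) (A q01 q00) (A q01 q01) (A q10 q10).
Proof.
move=> cA; have := bicommute_adj cA.
rewrite mul_raise_adj raise_adj_mul ?conjC0 ?conjC1 => /mx4P e'.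
have := cA.1; rewrite mul_raise raise_mul => /mx4P e.
have := (e q00 q11, e q01 q11, e q11 q11, e q10 q11, e q10 q00, e q10 q01).
have := (e' q00 q10, e' q01 q10, e' q10 q10, e' q11 q00, e' q11 q01).
rewrite !mxE /= ?(mul0r, mulr0, add0r, addr0, mul1r, mulr1).
move=> [[[[h1 h2] h3] h4] h5] [[[[[g1 g2] g3] g4] g5] g6].
by apply/mx4P; elim/ord4_ind; elim/ord4_ind; rewrite [RHS]mxE.
Qed.

(** The operator is a partial isometry from the span of |10>, |11> onto the span of |00>, |01>.
    Commuting with it and its adjoint reduces [A] to both planes and makes the two restrictions
    unitarily equivalent through diag(1, w). *)
Lemma block3_structure w A : w * w^* = 1 -> bicommute A (raise 0 1 w 0) ->
  A = block3 w (A q00 q00) (A q00 q01) (A q01 q00) (A q01 q01).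
Proof.
move=> ww cA; have := bicommute_adj cA.
rewrite mul_raise_adj raise_adj_mul ?conjC0 ?conjC1 => /mx4P e'.
have := cA.1; rewrite mul_raise raise_mul => /mx4P e.
have w0 : w != 0 by apply/eqP => w0; move/eqP: ww; rewrite w0 mul0r eq_sym oner_eq0.
have cw0 : w^* != 0 by rewrite conjC_eq0.
have := (e q00 q00, e q00 q01, e q00 q10, e q00 q11,
  (e q01 q00, e q01 q01, e q01 q10, e q01 q11)).
have := (e' q00 q00, e' q00 q01, e' q01 q00, e' q01 q01).
rewrite !mxE /= ?(mul0r, mulr0, add0r, addr0, mul1r, mulr1).
move=> [[[h1 h2] h3] h4] [[[[g1 g2] g3] g4] [[[f1 f2] f3] f4]].
have {}h2 : A q00 q11 = 0 by apply: (mulIf cw0); rewrite mul0r.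
have {}h4 : A q01 q11 = 0 by apply: (mulIf cw0); rewrite mul0r.
have {}f1 : A q11 q00 = 0 by apply: (mulfI w0); rewrite mulr0.
have {}f2 : A q11 q01 = 0 by apply: (mulfI w0); rewrite mulr0.
have {}f4 : A q11 q11 = A q01 q01 by apply: (mulfI w0); rewrite -f4 mulrC.
have {}f3 : A q11 q10 = w^* * A q01 q00 by rewrite f3 mulrA [w^* * w]mulrC ww mul1r.
by apply/mx4P; elim/ord4_ind; elim/ord4_ind; rewrite [RHS]mxE //= mulrC.
Qed.

Lemma block1_normal c a b b' d : block1 c a b b' d \is normalmx ->
  exists k m : R, b' = expi (2 * k) * b^* /\ d = a + m%:C * expi k.
Proof.
move=> /normalmxP/mx4P e; have := (e q10 q10, e q10 q11).
rewrite !mxE !sum4E !mxE /= !conjC0 ?(mul0r, mulr0, add0r, addr0) => -[e1 e2].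
apply: normal_block => //; apply: (addrI (a * a^*)).
by rewrite e1 [a * _]mulrC.
Qed.

Lemma block2_normal a b b' d c : block2 a b b' d c \is normalmx ->
  exists k m : R, b' = expi (2 * k) * b^* /\ d = a + m%:C * expi k.
Proof.
move=> /normalmxP/mx4P e; have := (e q00 q00, e q00 q01).
rewrite !mxE !sum4E !mxE /= !conjC0 ?(mul0r, mulr0, add0r, addr0) => -[e1 e2].
apply: normal_block => //; apply: (addrI (a * a^*)).
by rewrite e1 [a * _]mulrC.
Qed.

Lemma block3_normal w a b b' d : block3 w a b b' d \is normalmx ->
  exists k m : R, b' = expi (2 * k) * b^* /\ d = a + m%:C * expi k.
Proof.
move=> /normalmxP/mx4P e; have := (e q00 q00, e q00 q01).
rewrite !mxE !sum4E !mxE /= !conjC0 ?(mul0r, mulr0, add0r, addr0) => -[e1 e2].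
apply: normal_block => //; apply: (addrI (a * a^*)).
by rewrite e1 [a * _]mulrC.
Qed.

End Structure.

(** * The locking condition in the three adapted bases *)

Section Families.
Local Open Scope sesquilinear_scope.
Local Open Scope ring_scope.
Variable R : realType.
Local Notation C := R[i].
Local Notation op := 'M[C]_(2 * 2).
Local Notation r2 := ((Num.sqrt 2)^-1%:C : C).

Lemma r2_sqr : r2 * r2 + r2 * r2 = 1.
Proof.
have half : (Num.sqrt 2)^-1 * (Num.sqrt 2)^-1 + (Num.sqrt 2)^-1 * (Num.sqrt 2)^-1 = 1 :> R.
  by rewrite -invfM -expr2 sqr_sqrtr ?ler0n //; field.
by rewrite -rmorphM -rmorphD /= half.
Qed.

Lemma r2_neq0 : r2 != 0.
Proof. by apply/eqP => r0; have /eqP := r2_sqr; rewrite r0 mul0r addr0 eq_sym oner_eq0. Qed.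

Lemma T1_unitary (phi : R) : T1 phi \is unitarymx.
Proof.
apply: (@mid_unitary R r2 r2 (expi phi * r2) (- (expi phi * r2)));
  rewrite ?rmorphN ?rmorphM /= ?conj_expi ?conj_real; have := expiNM phi; have := r2_sqr.
- by [].
- move=> rr ee; transitivity (expi (- phi) * expi phi * (r2 * r2 + r2 * r2)); first by ring.
  by rewrite rr ee mulr1.
by move=> _ _; ring.
Qed.

Lemma T2_unitary (phi : R) : T2 phi \is unitarymx.
Proof.
apply: (@mid_unitary R r2 r2 (- (expi phi * r2)) (expi phi * r2));
  rewrite ?rmorphN ?rmorphM /= ?conj_expi ?conj_real; have := expiNM phi; have := r2_sqr.
- by [].
- move=> rr ee; transitivity (expi (- phi) * expi phi * (r2 * r2 + r2 * r2)); first by ring.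
  by rewrite rr ee mulr1.
by move=> _ _; ring.
Qed.

Lemma Ttheta_unitary (phi theta : R) : Ttheta phi theta \is unitarymx.
Proof.
apply: (@mid_unitary R ('i * expi (- phi) * (sin theta)%:C) ((cos theta)%:C)
  (- (cos theta)%:C) (- ('i * expi phi * (sin theta)%:C)));
  rewrite ?rmorphN ?rmorphM /= ?conj_expi ?conj_real ?conjCi ?opprK;
  have := expiNM phi; have := cos2Dsin2C theta; have := sqrCi C => ii cs ee.
- transitivity (- ('i ^+ 2) * (expi (- phi) * expi phi) * (sin theta)%:C ^+ 2 +
                (cos theta)%:C ^+ 2).
    by ring.
  by rewrite ii ee opprK !mul1r addrC.
- transitivity (- ('i ^+ 2) * (expi (- phi) * expi phi) * (sin theta)%:C ^+ 2 +
                (cos theta)%:C ^+ 2).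
    by ring.
  by rewrite ii ee opprK !mul1r addrC.
by ring.
Qed.

Variables (E0 E1 : R) (n : nat) (L : 'I_n -> op) (phi : R).
Hypothesis normalL : forall j, L j \is normalmx.
Local Notation e := (expi phi : C).

Definition commuting (B : 'I_n -> op) y1 y2 y3 y4 : Prop :=
  forall j, B j *m raise y1 y2 y3 y4 = raise y1 y2 y3 y4 *m B j.

(** The middle columns of [T1] are the normalised vectors |01> + e^(i phi) |10> and |01> - e^(i phi)
    |10>. Locking constrains only the coordinates [y2], [y4] along the second; under it they cancel
    from the partial trace, which leaves [y1 + e * y3] up to a nonzero factor. *)
Lemma phase_locking_T1 (u : 'I_n -> C) (B : 'I_n -> op) :
  (forall j, u j != 0) -> (forall j, u j *: L j = T1 phi *m B j *m (T1 phi)^t*) ->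
  phase_locking E0 E1 L phi <->
  (forall y1 y2 y3 y4, commuting B y1 y2 y3 y4 -> y2 = e * y4) /\
  (exists y1 y2 y3 y4, commuting B y1 y2 y3 y4 /\ y1 + e * y3 != 0).
Proof.
move=> u0 LB; rewrite (@phase_locking_basis R E0 E1 n L phi normalL r2 r2 (e * r2) (- (e * r2))
  u B (T1_unitary phi) u0 LB).
rewrite rmorphN !rmorphM /= !conj_expi !conj_real.
have ee := expiNM phi; have r0 := r2_neq0.
have lockE y1 y2 y3 y4 :
    (y1 * r2 + y2 * r2 + (e * r2 * y3 + - (e * r2) * y4) =
     e * (y1 * (expi (- phi) * r2) + y2 * - (expi (- phi) * r2) + (r2 * y3 + r2 * y4)))
    = (y2 = e * y4).
  rewrite (_ : e * (_ + (_ * y3 + _)) = expi (- phi) * e * (y1 * r2 - y2 * r2) + e * r2 * (y3 + y4));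
    last by ring.
  rewrite ee mul1r; apply/propext; split=> [eq|->]; last by ring.
  (* The two sides of the locking equation differ by 2 r2 (y2 - e y4). *)
  apply: (mulfI r0); apply: (mulfI (_ : 2 != 0)); first by rewrite pnatr_eq0.
  by apply/eqP; rewrite -subr_eq0; apply/eqP; move/eqP: eq; rewrite -subr_eq0 => /eqP <-; ring.
have neqE y1 y2 y3 y4 : y2 = e * y4 ->
    (y1 * (expi (- phi) * r2) + y2 * - (expi (- phi) * r2) + (r2 * y3 + r2 * y4) != 0)
    = (y1 + e * y3 != 0).
  move=> ->; rewrite (_ : _ + _ = expi (- phi) * r2 * (y1 + e * y3)).
    by rewrite !mulf_eq0 (negbTE r0) (negbTE (expi_neq0 _)).
  transitivity (r2 * (expi (- phi) * y1) + (1 - expi (- phi) * e) * r2 * y4 + r2 * y3);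
    first by ring.
  by rewrite ee subrr !mul0r addr0 -[y3 in LHS]mul1r -ee; ring.
split=> -[lock [y1 [y2 [y3 [y4 [comm y0]]]]]]; split.
- by move=> z1 z2 z3 z4 /lock; rewrite lockE.
- have := lock _ _ _ _ comm; rewrite lockE => y13.
  by exists y1, y2, y3, y4; split=> //; rewrite -(neqE y1 y2 y3 y4).
- by move=> z1 z2 z3 z4 /lock; rewrite lockE.
by exists y1, y2, y3, y4; split=> //; rewrite neqE //; apply: lock comm.
Qed.

(** [T2] is [T1] with the middle columns exchanged, so [y1], [y3] swap roles with [y2], [y4]. *)
Lemma phase_locking_T2 (u : 'I_n -> C) (B : 'I_n -> op) :
  (forall j, u j != 0) -> (forall j, u j *: L j = T2 phi *m B j *m (T2 phi)^t*) ->
  phase_locking E0 E1 L phi <->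
  (forall y1 y2 y3 y4, commuting B y1 y2 y3 y4 -> y1 = e * y3) /\
  (exists y1 y2 y3 y4, commuting B y1 y2 y3 y4 /\ y2 + e * y4 != 0).
Proof.
move=> u0 LB; rewrite (@phase_locking_basis R E0 E1 n L phi normalL r2 r2 (- (e * r2)) (e * r2)
  u B (T2_unitary phi) u0 LB).
rewrite rmorphN !rmorphM /= !conj_expi !conj_real.
have ee := expiNM phi; have r0 := r2_neq0.
have lockE y1 y2 y3 y4 :
    (y1 * r2 + y2 * r2 + (- (e * r2) * y3 + e * r2 * y4) =
     e * (y1 * - (expi (- phi) * r2) + y2 * (expi (- phi) * r2) + (r2 * y3 + r2 * y4)))
    = (y1 = e * y3).
  rewrite (_ : e * (_ + (_ * y3 + _)) = expi (- phi) * e * (y2 * r2 - y1 * r2) + e * r2 * (y3 + y4));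
    last by ring.
  rewrite ee mul1r; apply/propext; split=> [eq|->]; last by ring.
  apply: (mulfI r0); apply: (mulfI (_ : 2 != 0)); first by rewrite pnatr_eq0.
  by apply/eqP; rewrite -subr_eq0; apply/eqP; move/eqP: eq; rewrite -subr_eq0 => /eqP <-; ring.
have neqE y1 y2 y3 y4 : y1 = e * y3 ->
    (y1 * - (expi (- phi) * r2) + y2 * (expi (- phi) * r2) + (r2 * y3 + r2 * y4) != 0)
    = (y2 + e * y4 != 0).
  move=> ->; rewrite (_ : _ + _ = expi (- phi) * r2 * (y2 + e * y4)).
    by rewrite !mulf_eq0 (negbTE r0) (negbTE (expi_neq0 _)).
  transitivity (r2 * (expi (- phi) * y2) + (1 - expi (- phi) * e) * r2 * y3 + r2 * y4);
    first by ring.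
  by rewrite ee subrr !mul0r addr0 -[y4 in LHS]mul1r -ee; ring.
split=> -[lock [y1 [y2 [y3 [y4 [comm y0]]]]]]; split.
- by move=> z1 z2 z3 z4 /lock; rewrite lockE.
- have := lock _ _ _ _ comm; rewrite lockE => y13.
  by exists y1, y2, y3, y4; split=> //; rewrite -(neqE y1 y2 y3 y4).
- by move=> z1 z2 z3 z4 /lock; rewrite lockE.
by exists y1, y2, y3, y4; split=> //; rewrite neqE //; apply: lock comm.
Qed.

(** The entries cos and i sin combine into e^(-i theta) and e^(i theta). With [y1 = y4 = 0] the
    condition reads y3 = e^(-2i theta) y2, which is the factor [w] of [block3]. *)
Lemma phase_locking_Ttheta (theta : R) (u : 'I_n -> C) (B : 'I_n -> op) :
  (forall j, u j != 0) ->
  (forall j, u j *: L j = Ttheta phi theta *m B j *m (Ttheta phi theta)^t*) ->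
  phase_locking E0 E1 L phi <->
  (forall y1 y2 y3 y4, commuting B y1 y2 y3 y4 ->
     expi (- theta) * (y2 + e * y1) = expi theta * (y3 + e * y4)) /\
  (exists y1 y2 y3 y4, commuting B y1 y2 y3 y4 /\
     (cos theta)%:C * (y4 - y1) + 'i * expi (- phi) * (sin theta)%:C * (y2 + y3) != 0).
Proof.
move=> u0 LB; rewrite (@phase_locking_basis R E0 E1 n L phi normalL
  ('i * expi (- phi) * (sin theta)%:C) ((cos theta)%:C)
  (- (cos theta)%:C) (- ('i * expi phi * (sin theta)%:C)) u B
  (Ttheta_unitary phi theta) u0 LB).
rewrite !rmorphN !rmorphM /= !conj_expi !conj_real !conjCi opprK -!/(commuting _ _ _ _ _).
have ee := expiNM phi.
have lockE y1 y2 y3 y4 :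
    (y1 * (- 'i * expi phi * (sin theta)%:C) + y2 * (cos theta)%:C +
       (- (cos theta)%:C * y3 + - ('i * expi phi * (sin theta)%:C) * y4) =
     expi phi * (y1 * - (cos theta)%:C + y2 * - (- 'i * expi (- phi) * (sin theta)%:C) +
       ('i * expi (- phi) * (sin theta)%:C * y3 + (cos theta)%:C * y4)))
    = (expi (- theta) * (y2 + e * y1) = expi theta * (y3 + e * y4)).
  rewrite [expi (- theta)]expiE cosN sinN [expi theta]expiE.
  rewrite (_ : e * (_ + (_ + (cos theta)%:C * y4)) =
    expi (- phi) * e * ('i * (sin theta)%:C * (y2 + y3)) +
    e * (cos theta)%:C * (y4 - y1)); last by ring.
  rewrite ee mul1r rmorphN; apply/propext; split=> /eqP; rewrite -subr_eq0 => /eqP eq0;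
    by apply/eqP; rewrite -subr_eq0; apply/eqP; rewrite -[RHS]eq0; ring.
have neqE y1 y2 y3 y4 :
    y1 * - (cos theta)%:C + y2 * - (- 'i * expi (- phi) * (sin theta)%:C) +
       ('i * expi (- phi) * (sin theta)%:C * y3 + (cos theta)%:C * y4) =
    (cos theta)%:C * (y4 - y1) + 'i * expi (- phi) * (sin theta)%:C * (y2 + y3) by ring.
split=> -[lock [y1 [y2 [y3 [y4 [comm y0]]]]]]; split.
- by move=> z1 z2 z3 z4 /lock; rewrite lockE.
- by exists y1, y2, y3, y4; split=> //; rewrite -neqE.
- by move=> z1 z2 z3 z4 /lock; rewrite lockE.
by exists y1, y2, y3, y4; split=> //; rewrite neqE.
Qed.

End Families.

(** * Commutation under scaling and change of basis *)

Section Commutation.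
Local Open Scope sesquilinear_scope.
Variables (F : numClosedFieldType) (n : nat).
Implicit Types A X T : 'M[F]_n.

Lemma normalZ (u : F) A : A \is normalmx -> u *: A \is normalmx.
Proof.
move=> /normalmxP AA; apply/normalmxP.
by rewrite adjmxZ -!(scalemxAl, scalemxAr) AA !scalerA mulrC.
Qed.

Lemma commutesZ (z : F) A X : A *m X = X *m A -> A *m (z *: X) = (z *: X) *m A.
Proof. by move=> cAX; rewrite -scalemxAr cAX scalemxAl. Qed.

Lemma Zcommutes (z : F) A X : A *m X = X *m A -> (z *: A) *m X = X *m (z *: A).
Proof. by move=> cAX; rewrite -scalemxAl cAX scalemxAr. Qed.

Lemma commute_in_basis T A X : T \is unitarymx -> A \is normalmx ->
  A *m (T *m X *m T^t*) = (T *m X *m T^t*) *m A ->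
  T^t* *m A *m T \is normalmx /\ (T^t* *m A *m T) *m X = X *m (T^t* *m A *m T).
Proof.
move=> uT nA cAX; split.
  have uT' : T^t* \is unitarymx by rewrite trmxC_unitary.
  by have := unitary_conj_normal uT' nA; rewrite trmxCK.
by apply/(unitary_conj_commute _ _ uT); rewrite unitary_conjK.
Qed.

Lemma scale_in_basis (z : F) A T : T \is unitarymx ->
  z *: A = T *m (z *: (T^t* *m A *m T)) *m T^t*.
Proof. by move=> uT; rewrite -scalemxAr -scalemxAl unitary_conjK. Qed.

End Commutation.

(** * From the three families to locking, and from canonical commuting elements back *)

Section Characterization.
Local Open Scope sesquilinear_scope.
Local Open Scope ring_scope.
Variable R : realType.
Local Notation C := R[i].
Local Notation op := 'M[C]_(2 * 2).
Local Notation r2 := ((Num.sqrt 2)^-1%:C : C).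
Implicit Types (A : op).

Lemma unimodular_neq0 (u : C) : `|u| = 1 -> u != 0.
Proof. by move=> u1; rewrite -normr_eq0 u1 oner_eq0. Qed.

(** Source of the unimodular factors for the first two families: they make the scalar [c] of the
    block real. *)
Lemma rotate_to_real (z : C) : exists (u : C) (c : R), `|u| = 1 /\ u * z = c%:C.
Proof.
have [m [k ->]] := polar z; exists (expi (- k)), m; split; last first.
  by rewrite mulrCA expiNM mulr1.
by apply/eqP; rewrite -(@eqrXn2 _ 2) ?normr_ge0 ?ler01 // normCK conj_expi expr1n mulrC expiNM.
Qed.

Lemma raiseZ (z x1 x2 x3 x4 : C) :
  raise (z * x1) (z * x2) (z * x3) (z * x4) = z *: raise x1 x2 x3 x4.
Proof.
by apply/mx4P; elim/ord4_ind; elim/ord4_ind; rewrite !mxE /= ?mulr0.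
Qed.

Lemma block1_phase A : A \is normalmx -> A *m raise 1 0 0 0 = raise 1 0 0 0 *m A ->
  exists (u a b : C) (c k m : R), `|u| = 1 /\
    u *: A = block1 c%:C a b (expi (2 * k) * b^*) (a + m%:C * expi k).
Proof.
move=> nA cA; have [u [c [u1 uc]]] := rotate_to_real (A q00 q00).
have nuA := normalZ u nA.
have cuA : bicommute (u *: A) (raise 1 0 0 0).
  exact/(fuglede nuA)/Zcommutes.
have uAE := block1_structure cuA; move: nuA; rewrite uAE => /block1_normal[k [m [e1 e2]]].
exists u, ((u *: A) q10 q10), ((u *: A) q10 q11), c, k, m; split=> //.
by rewrite -e1 -e2 -uc; rewrite {1}uAE; congr block1; rewrite mxE.
Qed.

Lemma block2_phase A : A \is normalmx -> A *m raise 0 0 0 1 = raise 0 0 0 1 *m A ->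
  exists (u a b : C) (c k m : R), `|u| = 1 /\
    u *: A = block2 a b (expi (2 * k) * b^*) (a + m%:C * expi k) c%:C.
Proof.
move=> nA cA; have [u [c [u1 uc]]] := rotate_to_real (A q10 q10).
have nuA := normalZ u nA.
have cuA : bicommute (u *: A) (raise 0 0 0 1).
  exact/(fuglede nuA)/Zcommutes.
have uAE := block2_structure cuA; move: nuA; rewrite uAE => /block2_normal[k [m [e1 e2]]].
exists u, ((u *: A) q00 q00), ((u *: A) q00 q01), c, k, m; split=> //.
by rewrite -e1 -e2 -uc; rewrite {1}uAE; congr block2; rewrite mxE.
Qed.

Lemma SthetaE (phi theta : R) (a b : C) (k m : R) : Stheta phi theta a b k m =
  Ttheta phi theta *m
  block3 (expi (- (2 * theta))) a b (expi (2 * k) * b^*) (a + m%:C * expi k) *m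
  (Ttheta phi theta)^t*.
Proof. by rewrite /Stheta /block3 conj_expi opprK mulrA. Qed.

Variables (E0 E1 : R) (n : nat) (L : 'I_n -> op) (phi : R).
Hypothesis normalL : forall j, L j \is normalmx.
Local Notation e := (expi phi : C).

(** A nonzero [b j] kills both [y2] and [y4]; otherwise [a j != c j] kills [y2] and [m l != 0] kills
    [y4]. The free coordinate [y1] supplies the nontrivial element. *)
Lemma S1_locking (u a b : 'I_n -> C) (c k m : 'I_n -> R) :
  (forall j, `|u j| = 1) ->
  (forall j, u j *: L j = S1 phi (a j) (b j) (c j) (k j) (m j)) ->
  ((exists j, b j != 0) \/ (exists j l, a j != (c j)%:C /\ m l != 0)) ->
  phase_locking E0 E1 L phi.
Proof.
move=> u1 LS nontriv; apply/(phase_locking_T1 E0 E1 normalL _ LS) => [j|].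
  exact: unimodular_neq0.
split=> [y1 y2 y3 y4 comm|].
  have {}comm j := (block1_raise _ _ _ _ _ _ _ _ _).1 (comm j).
  have [y2_0 y4_0] : y2 = 0 /\ y4 = 0; last by rewrite y2_0 y4_0 mulr0.
  case: nontriv => [[j bj]|[j [l [ajcj ml]]]].
    have [_ /eqP h2 _ _ [_ /eqP h6]] := comm j; move: h2 h6.
    rewrite !mulf_eq0 (negbTE bj) conjC_eq0 (negbTE bj) (negbTE (expi_neq0 _)) !orbF.
    by move=> /eqP-> /eqP->.
  have [/eqP h1 _ _ _ _] := comm j; have [_ _ _ _ [/eqP h5 _]] := comm l.
  move: h1 h5; rewrite !mulf_eq0 subr_eq0 (negbTE ajcj) orbF => /eqP->.
  (* The gap between the diagonal entries [a l] and [a l + m l * expi (k l)] is nonzero because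
     [m l] is. *)
  rewrite opprD addNKr oppr_eq0 mulf_eq0 (negbTE (expi_neq0 _)) orbF.
  by rewrite fmorph_eq0 (negbTE ml) orbF => /eqP.
exists 1, 0, 0, 0; split; last by rewrite mulr0 addr0 oner_eq0.
by move=> j; apply/block1_raise; rewrite !mul0r.
Qed.

Lemma S2_locking (u a b : 'I_n -> C) (c k m : 'I_n -> R) :
  (forall j, `|u j| = 1) ->
  (forall j, u j *: L j = S2 phi (a j) (b j) (c j) (k j) (m j)) ->
  ((exists j, b j != 0) \/
   (exists j l, a j + (m j)%:C * expi (k j) != (c j)%:C /\ m l != 0)) ->
  phase_locking E0 E1 L phi.
Proof.
move=> u1 LS nontriv; apply/(phase_locking_T2 E0 E1 normalL _ LS) => [j|].
  exact: unimodular_neq0.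
split=> [y1 y2 y3 y4 comm|].
  have {}comm j := (block2_raise _ _ _ _ _ _ _ _ _).1 (comm j).
  have [y1_0 y3_0] : y1 = 0 /\ y3 = 0; last by rewrite y1_0 y3_0 mulr0.
  case: nontriv => [[j bj]|[j [l [djcj ml]]]].
    have [_ /eqP h2 _ _ [_ /eqP h6]] := comm j; move: h2 h6.
    rewrite !mulf_eq0 (negbTE bj) conjC_eq0 (negbTE bj) (negbTE (expi_neq0 _)) !orbF.
    by move=> /eqP-> /eqP->.
  have [_ _ _ _ [/eqP h5 _]] := comm j; have [/eqP h1 _ _ _ _] := comm l.
  move: h1 h5; rewrite !mulf_eq0 [_ - (c j)%:C == 0]subr_eq0 (negbTE djcj) orbF => h1 /eqP->.
  move: h1; rewrite opprD addNKr oppr_eq0 mulf_eq0 (negbTE (expi_neq0 _)) orbF.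
  by rewrite fmorph_eq0 (negbTE ml) orbF => /eqP.
exists 0, 0, 0, 1; split; last by rewrite mulr1 add0r expi_neq0.
by move=> j; apply/block2_raise; rewrite !mul0r.
Qed.

Lemma sin_neq0_pihalf (theta : R) :
  - (pi / 2) < theta < 0 \/ 0 < theta < pi / 2 -> sin theta != 0.
Proof.
have pi0 := pi_gt0 R; case=> /andP[t1 t2].
  rewrite -oppr_eq0 -sinN gt_eqF // sin_gt0_pi //; lra.
rewrite gt_eqF // sin_gt0_pi //; lra.
Qed.

Lemma cos_neq0_pihalf (theta : R) :
  - (pi / 2) < theta < 0 \/ 0 < theta < pi / 2 -> cos theta != 0.
Proof.
have pi0 := pi_gt0 R => t; rewrite gt_eqF // cos_gt0_pihalf //.
case: t => /andP[t1 t2]; lra.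
Qed.

(** A nonzero [b j] forces [y1 = y4 = 0] and [y3 = w * y2], which is exactly a locked element. *)
Lemma Stheta_locking (theta : R) (u a b : 'I_n -> C) (k m : 'I_n -> R) :
  (- (pi / 2) < theta < 0 \/ 0 < theta < pi / 2) ->
  (forall j, `|u j| = 1) ->
  (forall j, u j *: L j = Stheta phi theta (a j) (b j) (k j) (m j)) ->
  (exists j, b j != 0) ->
  phase_locking E0 E1 L phi.
Proof.
move=> t_range u1 LS [j bj].
have {}LS i : u i *: L i = _ := etrans (LS i) (SthetaE _ _ _ _ _ _).
set w := expi (- (2 * theta)) in LS.
have ww : w * w^* = 1 by rewrite conj_expi -expiD subrr expi0.
have wE : expi theta * w = expi (- theta) by rewrite -expiD; congr expi; ring.
apply/(phase_locking_Ttheta E0 E1 normalL _ LS) => [i|].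
  exact: unimodular_neq0.
split=> [y1 y2 y3 y4 comm|].
  have [_ /eqP h2 /eqP h3 _ [_ /eqP h6]] := (block3_raise _ _ _ _ _ _ _ _ ww).1 (comm j).
  move: h2 h3 h6.
  rewrite !mulf_eq0 (negbTE bj) conjC_eq0 (negbTE bj) (negbTE (expi_neq0 _)) !orbF.
  by rewrite subr_eq0 => /eqP-> /eqP-> /eqP->; rewrite !mulr0 !addr0 mulrA wE.
exists 0, 1, w, 0; split.
  by move=> i; apply/(block3_raise _ _ _ _ _ _ _ _ ww); rewrite !mul0r mulr1 subrr !mulr0.
rewrite subrr mulr0 add0r !mulf_eq0 negb_or.
(* Factoring out the half angle shows that the trace is nonzero because neither sine nor cosine of
   [theta] vanishes. *)
have -> : 1 + w = expi (- theta) * (2 * (cos theta)%:C).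
  have -> : 2 * (cos theta)%:C = expi theta + expi (- theta) :> C.
    by rewrite !expiE cosN sinN rmorphN; ring.
  by rewrite mulrDr expiNM -expiD; congr (1 + expi _); ring.
rewrite !mulf_eq0 !negb_or !expi_neq0 pnatr_eq0 neq0Ci !fmorph_eq0.
by rewrite sin_neq0_pihalf ?cos_neq0_pihalf.
Qed.

(** In the basis [T1] the given element is a multiple of |00><01|, whence the block form. The
    nontriviality clause follows by contradiction: its failure lets an unlocked element commute. *)
Lemma locking_S1 :
  phase_locking E0 E1 L phi ->
  (forall j, L j *m raise e 1 0 0 = raise e 1 0 0 *m L j) ->
  exists (u a b : 'I_n -> C) (c k m : 'I_n -> R),
    [/\ forall j, `|u j| = 1,
        forall j, u j *: L j = S1 phi (a j) (b j) (c j) (k j) (m j) &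
        (exists j, b j != 0) \/ (exists j l, a j != (c j)%:C /\ m l != 0)].
Proof.
move=> lock comm; have uT := T1_unitary phi.
(* Bra coordinates are conjugates of the column entries: (r2, e^(-i phi) r2) is e^(-i phi) r2 times
   (e, 1). *)
have raiseE : (expi (- phi) * r2) *: raise e 1 0 0 =
    T1 phi *m raise 1 0 0 0 *m (T1 phi)^t*.
  rewrite (mid_raise r2 r2 (e * r2) (- (e * r2)) 1 0 0 0) -raiseZ.
  rewrite !rmorphM /= conj_real conj_expi !(mul0r, mulr0, mul1r, mulr1, addr0).
  by rewrite mulrAC expiNM mul1r.
(* All parameters are packed into one tuple, so a single use of [choice] yields the families. *)
have phase j : exists t : C * C * C * (R * R * R),
    `|t.1.1.1| = 1 /\ t.1.1.1 *: L j = S1 phi t.1.1.2 t.1.2 t.2.1.1 t.2.1.2 t.2.2.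
  have := commutesZ (expi (- phi) * r2) (comm j); rewrite raiseE.
  move=> /(commute_in_basis uT (normalL j))[nA /(block1_phase nA)].
  move=> [u [a [b [c [k [m [u1 uA]]]]]]]; exists (u, a, b, (c, k, m)); split=> //=.
  by rewrite (scale_in_basis u (L j) uT) uA.
have [t tP] := choice phase.
pose u j := (t j).1.1.1; pose a j := (t j).1.1.2; pose b j := (t j).1.2.
pose c j := (t j).2.1.1; pose k j := (t j).2.1.2; pose m j := (t j).2.2.
have u1 j : `|u j| = 1 by have [] := tP j.
have LS j : u j *: L j = S1 phi (a j) (b j) (c j) (k j) (m j) by have [] := tP j.
exists u, a, b, c, k, m; split=> //.
have u0 j := unimodular_neq0 (u1 j).
have [locked _] := (phase_locking_T1 E0 E1 normalL u0 LS).1 lock.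
have [[j bj]|b_ex] := pselect (exists j, b j != 0); [by left; exists j | right].
have b0 j : b j = 0 by apply/eqP; apply: contra_notT b_ex => bj; exists j.
(* If every [a j] equals [c j], then [y2 = 1] alone commutes, against [y2 = e * y4]. *)
have [[j aj]|a_ex] := pselect (exists j, a j != (c j)%:C); last first.
  have ac j : a j = (c j)%:C by apply/eqP; apply: contra_notT a_ex => aj; exists j.
  suff /eqP : (1 : C) = e * 0 by rewrite mulr0 oner_eq0.
  apply: (locked 0 1 0 0) => j; apply/block1_raise.
  by rewrite ac b0 subrr !(mul0r, mulr0).
have [[l ml]|m_ex] := pselect (exists l, m l != 0); first by exists j, l.
have m0 l : m l = 0 by apply/eqP; apply: contra_notT m_ex => ml; exists l.
(* If every [m l] vanishes, then [y4 = 1] alone commutes, against the same condition. *)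
suff /eqP : 0 = e * 1 by rewrite mulr1 eq_sym (negbTE (expi_neq0 _)).
apply: (locked 0 0 0 1) => l; apply/block1_raise.
by rewrite m0 b0 rmorph0 conjC0 !(mul0r, mulr0, addr0) subrr mulr0.
Qed.

(** Mirror image of [locking_S1] on the ket side: the unlocked elements used against triviality are
    now [y3 = 1] and [y1 = 1]. *)
Lemma locking_S2 :
  phase_locking E0 E1 L phi ->
  (forall j, L j *m raise 0 0 1 e = raise 0 0 1 e *m L j) ->
  exists (u a b : 'I_n -> C) (c k m : 'I_n -> R),
    [/\ forall j, `|u j| = 1,
        forall j, u j *: L j = S2 phi (a j) (b j) (c j) (k j) (m j) &
        (exists j, b j != 0) \/
        (exists j l, a j + (m j)%:C * expi (k j) != (c j)%:C /\ m l != 0)].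
Proof.
move=> lock comm; have uT := T2_unitary phi.
have raiseE : r2 *: raise 0 0 1 e = T2 phi *m raise 0 0 0 1 *m (T2 phi)^t*.
  rewrite (mid_raise r2 r2 (- (e * r2)) (e * r2) 0 0 0 1) -raiseZ.
  by rewrite !(mul0r, mulr0, mul1r, mulr1, addr0, add0r) mulrC.
have phase j : exists t : C * C * C * (R * R * R),
    `|t.1.1.1| = 1 /\ t.1.1.1 *: L j = S2 phi t.1.1.2 t.1.2 t.2.1.1 t.2.1.2 t.2.2.
  have := commutesZ r2 (comm j); rewrite raiseE.
  move=> /(commute_in_basis uT (normalL j))[nA /(block2_phase nA)].
  move=> [u [a [b [c [k [m [u1 uA]]]]]]]; exists (u, a, b, (c, k, m)); split=> //=.
  by rewrite (scale_in_basis u (L j) uT) uA.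
have [t tP] := choice phase.
pose u j := (t j).1.1.1; pose a j := (t j).1.1.2; pose b j := (t j).1.2.
pose c j := (t j).2.1.1; pose k j := (t j).2.1.2; pose m j := (t j).2.2.
have u1 j : `|u j| = 1 by have [] := tP j.
have LS j : u j *: L j = S2 phi (a j) (b j) (c j) (k j) (m j) by have [] := tP j.
exists u, a, b, c, k, m; split=> //.
have u0 j := unimodular_neq0 (u1 j).
have [locked _] := (phase_locking_T2 E0 E1 normalL u0 LS).1 lock.
have [[j bj]|b_ex] := pselect (exists j, b j != 0); [by left; exists j | right].
have b0 j : b j = 0 by apply/eqP; apply: contra_notT b_ex => bj; exists j.
have [[j dj]|d_ex] := pselect (exists j, a j + (m j)%:C * expi (k j) != (c j)%:C); last first.
  have dc j : a j + (m j)%:C * expi (k j) = (c j)%:C.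
    by apply/eqP; apply: contra_notT d_ex => dj; exists j.
  suff /eqP : 0 = e * 1 by rewrite mulr1 eq_sym (negbTE (expi_neq0 _)).
  apply: (locked 0 0 1 0) => j; apply/block2_raise.
  by rewrite dc b0 subrr !(mul0r, mulr0).
have [[l ml]|m_ex] := pselect (exists l, m l != 0); first by exists j, l.
have m0 l : m l = 0 by apply/eqP; apply: contra_notT m_ex => ml; exists l.
suff /eqP : (1 : C) = e * 0 by rewrite mulr0 oner_eq0.
apply: (locked 1 0 0 0) => l; apply/block2_raise.
by rewrite m0 b0 rmorph0 conjC0 !(mul0r, mulr0, addr0) subrr mulr0.
Qed.

(** The given element is |00><10| + w |01><11| in the basis [Ttheta]. No phases are inserted, since
    this block form has no parameter that must be made real. *)
Lemma locking_Stheta (theta : R) :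
  phase_locking E0 E1 L phi ->
  let c := (cos theta)%:C in let s := 'i * expi (- phi) * (sin theta)%:C in
  let w := expi (- (2 * theta)) in
  (forall j, L j *m raise c s (s * w) (- c * w) = raise c s (s * w) (- c * w) *m L j) ->
  exists (a b : 'I_n -> C) (k m : 'I_n -> R),
    (forall j, L j = Stheta phi theta (a j) (b j) (k j) (m j)) /\
    (exists j, b j != 0).
Proof.
move=> lock c s w comm; have uT := Ttheta_unitary phi theta.
have ww : w * w^* = 1 by rewrite conj_expi -expiD subrr expi0.
have raiseE : raise c s (s * w) (- c * w) =
    Ttheta phi theta *m raise 0 1 w 0 *m (Ttheta phi theta)^t*.
  rewrite (mid_raise s c (- c) (- ('i * expi phi * (sin theta)%:C)) 0 1 w 0).
  rewrite !rmorphN !rmorphM /= !conj_expi !conj_real conjCi.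
  by rewrite !(mul0r, mulr0, mul1r, addr0, add0r) !mulNr !opprK.
have phase j : exists t : C * C * (R * R), L j = Stheta phi theta t.1.1 t.1.2 t.2.1 t.2.2.
  have := comm j; rewrite raiseE.
  move=> /(commute_in_basis uT (normalL j))[nA /(fuglede nA) cA].
  have AE := block3_structure ww cA; move: nA; rewrite AE => /block3_normal[k [m [e1 e2]]].
  exists (((Ttheta phi theta)^t* *m L j *m Ttheta phi theta) q00 q00,
          ((Ttheta phi theta)^t* *m L j *m Ttheta phi theta) q00 q01, (k, m)).
  by rewrite SthetaE /= -e1 -e2 -AE unitary_conjK.
have [t tP] := choice phase.
pose a j := (t j).1.1; pose b j := (t j).1.2; pose k j := (t j).2.1; pose m j := (t j).2.2.
have LS j : L j = Stheta phi theta (a j) (b j) (k j) (m j) by exact: tP.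
exists a, b, k, m; split=> //.
have LS1 j : 1 *: L j = _ := etrans (scale1r (L j)) (etrans (LS j) (SthetaE _ _ _ _ _ _)).
have [locked _] := (phase_locking_Ttheta E0 E1 normalL (fun=> oner_neq0 _) LS1).1 lock.
have [[j bj]|b_ex] := pselect (exists j, b j != 0); first by exists j.
have b0 j : b j = 0 by apply/eqP; apply: contra_notT b_ex => bj; exists j.
(* Were all [b j] zero, [y2 = 1] alone would commute without being locked. *)
suff /eqP : expi (- theta) * (1 + e * 0) = expi theta * (0 + e * 0).
  by rewrite !mulr0 !addr0 mulr1 mulr0 (negbTE (expi_neq0 _)).
apply: (locked 0 1 0 0) => j; apply/(block3_raise _ _ _ _ _ _ _ _ ww).
by rewrite b0 conjC0 !(mul0r, mulr0).
Qed.

End Characterization.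

(** * Closure of the commutant and extraction of canonical elements *)

Lemma commutesM (F : pzRingType) n (A X Y : 'M[F]_n) :
  A *m X = X *m A -> A *m Y = Y *m A -> A *m (X *m Y) = (X *m Y) *m A.
Proof. by move=> cX cY; rewrite mulmxA cX -mulmxA cY mulmxA. Qed.

Section Commutant.
Local Open Scope sesquilinear_scope.
Local Open Scope ring_scope.
Variable R : realType.
Local Notation C := R[i].
Local Notation op := 'M[C]_(2 * 2).

Lemma raiseM (x1 x2 x3 x4 : C) : raise x1 x2 x3 x4 *m raise x1 x2 x3 x4 =
  (x1 * x3 + x2 * x4) *: delta_mx q00 q11.
Proof.
by apply/mx4P; elim/ord4_ind; elim/ord4_ind;
  rewrite !mxE sum4E !mxE /= ?(mul0r, mulr0, add0r, addr0, mulr1).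
Qed.

Lemma raise_square_adj (x1 x2 x3 x4 : C) :
  raise x1 x2 x3 x4 *m raise x1 x2 x3 x4 *m (raise x1 x2 x3 x4)^t* =
  (x1 * x3 + x2 * x4) *: raise x3^* x4^* 0 0.
Proof.
rewrite raiseM raise_adj -scalemxAl; congr (_ *: _).
by apply/mx4P; elim/ord4_ind; elim/ord4_ind;
  rewrite !mxE sum4E !mxE /= ?(mul0r, mulr0, mul1r, add0r, addr0).
Qed.

Lemma raise_adj_raise (x1 x2 x3 x4 : C) :
  raise x1 x2 x3 x4 *m ((raise x1 x2 x3 x4)^t* *m raise x1 x2 x3 x4) =
  raise ((x1 * x1^* + x2 * x2^*) * x1) ((x1 * x1^* + x2 * x2^*) * x2)
        ((x3 * x3^* + x4 * x4^*) * x3) ((x3 * x3^* + x4 * x4^*) * x4).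
Proof.
rewrite raise_mul mul_raise raise_adj.
by apply/mx4P; elim/ord4_ind; elim/ord4_ind; rewrite !mxE /= ?(mul0r, mulr0, addr0) //; ring.
Qed.

Variables (n : nat) (L : 'I_n -> op).
Hypothesis normalL : forall j, L j \is normalmx.

(** Fuglede puts the adjoint of X into the commutant. For X = |00><p| + |q><11|, the product of X, X
    and this adjoint is <p|q> |00><q|. *)
Lemma commuting_square_adj x1 x2 x3 x4 : commuting L x1 x2 x3 x4 ->
  commuting L ((x1 * x3 + x2 * x4) * x3^*) ((x1 * x3 + x2 * x4) * x4^*) 0 0.
Proof.
move=> comm j; have cX := comm j.
have cX' := bicommute_adj (fuglede (normalL j) cX).
have := raiseZ (x1 * x3 + x2 * x4) x3^* x4^* 0 0; rewrite !mulr0 => ->.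
by rewrite -raise_square_adj; apply: commutesM => //; apply: commutesM.
Qed.

(** X times its adjoint times X equals |p|^2 |00><p| + |q|^2 |q><11|; subtracting |q|^2 X removes
    the second summand. *)
Lemma commuting_adj_raise x1 x2 x3 x4 : commuting L x1 x2 x3 x4 ->
  let d := x1 * x1^* + x2 * x2^* - (x3 * x3^* + x4 * x4^*) in
  commuting L (d * x1) (d * x2) 0 0.
Proof.
move=> comm d j; have cX := comm j.
have cX' := bicommute_adj (fuglede (normalL j) cX).
have c3 := commutesM cX (commutesM cX' cX).
rewrite raise_adj_raise in c3.
have -> : raise (d * x1) (d * x2) 0 0 =
    raise ((x1 * x1^* + x2 * x2^*) * x1) ((x1 * x1^* + x2 * x2^*) * x2)
        ((x3 * x3^* + x4 * x4^*) * x3) ((x3 * x3^* + x4 * x4^*) * x4)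
    - (x3 * x3^* + x4 * x4^*) *: raise x1 x2 x3 x4.
  by apply/mx4P; elim/ord4_ind; elim/ord4_ind; rewrite !mxE /= /d; ring.
by rewrite mulmxBr mulmxBl c3 (commutesZ _ cX).
Qed.

Variable phi : R.
Local Notation e := (expi phi : C).
Hypothesis locked : forall x1 x2 x3 x4, commuting L x1 x2 x3 x4 ->
  x1 + x4 = e * (x2 + x3).

(** Without a ket part, locking reads [x1 = e * x2], which fixes the element up to a scalar. *)
Lemma commuting_plus_bra x1 x2 : commuting L x1 x2 0 0 ->
  (x1 != 0) || (x2 != 0) -> commuting L e 1 0 0.
Proof.
move=> comm x0; have := locked comm; rewrite !addr0 => x12.
have x20 : x2 != 0.
  by apply: contraTneq x0 => x20; rewrite x12 x20 mulr0 eqxx.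
move=> j; have -> : raise e 1 0 0 = x2^-1 *: raise x1 x2 0 0.
  by rewrite -raiseZ !mulr0 mulVf // x12 mulrCA mulVf // mulr1.
exact: commutesZ.
Qed.

Lemma commuting_plus_ket x3 x4 : commuting L 0 0 x3 x4 ->
  x3 != 0 -> commuting L 0 0 1 e.
Proof.
move=> comm x0 j; have := locked comm; rewrite !add0r => x34.
have -> : raise 0 0 1 e = x3^-1 *: raise 0 0 x3 x4.
  by rewrite -raiseZ !mulr0 mulVf // x34 mulrCA mulVf // mulr1.
exact: commutesZ.
Qed.

(** Here [x3 = w x2] and [x4 = - w x1] with [|w| = 1], so the locking condition
    reads [x1 (1 - w) = e x2 (1 + w)]; then [(1 - w) / (i (1 + w))] is real, and
    it is the tangent of [theta]. *)
Lemma commuting_theta x1 x2 x3 x4 : commuting L x1 x2 x3 x4 ->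
  x2 + x3 != 0 -> (x1 != 0) || (x2 != 0) ->
  x1 * x1^* + x2 * x2^* = x3 * x3^* + x4 * x4^* -> x1 * x3 + x2 * x4 = 0 ->
  exists theta : R, (- (pi / 2) < theta < 0 \/ 0 < theta < pi / 2) /\
    commuting L (cos theta)%:C ('i * expi (- phi) * (sin theta)%:C)
      ('i * expi (- phi) * (sin theta)%:C * expi (- (2 * theta)))
      (- (cos theta)%:C * expi (- (2 * theta))).
Proof.
move=> comm x23 x12 norm_eq orth.
have x2_0 : x2 != 0.
  (* If [x2] vanished, [x3] would be nonzero and orthogonality would force [x1 = 0] as well. *)
  apply/eqP => x2_0; move: x23 orth x12; rewrite x2_0 add0r mul0r addr0 eqxx orbF.
  by move=> x3_0 /eqP; rewrite mulf_eq0 (negbTE x3_0) orbF => ->.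
have [w x3E] : exists w, x3 = w * x2 by exists (x3 / x2); rewrite divfK.
have x4E : x4 = - (w * x1).
  apply: (mulfI x2_0); apply/eqP; rewrite -subr_eq0; apply/eqP; rewrite -orth x3E; ring.
have P0 : x1 * x1^* + x2 * x2^* != 0.
  rewrite paddr_eq0 ?mul_conjC_ge0 // negb_and; apply/orP; right.
  by rewrite mul_conjC_eq0.
have ww : w * w^* = 1.
  apply: (mulIf P0); rewrite mul1r {2}norm_eq x3E x4E rmorphN !rmorphM /=; ring.
have w1_0 : 1 + w != 0.
  move: x23; rewrite x3E (_ : x2 + w * x2 = (1 + w) * x2); last by ring.
  by rewrite mulf_eq0 negb_or => /andP[].
have x1w : x1 * (1 - w) = e * x2 * (1 + w).
  have := locked comm; rewrite x3E x4E => eq1.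
  by rewrite mulrBr mulr1 [x1 * w]mulrC eq1; ring.
have [x1_0 wn1_0] : x1 != 0 /\ 1 - w != 0.
  apply/andP; rewrite -negb_or -mulf_eq0 x1w !mulf_eq0 !negb_or expi_neq0.
  by rewrite x2_0.
have iw0 : 'i * (1 + w) != 0 by rewrite mulf_neq0 ?neq0Ci.
have [t tE] : exists t, t * ('i * (1 + w)) = 1 - w.
  by exists ((1 - w) / ('i * (1 + w))); rewrite divfK.
have [tau tauE] : exists tau : R, t = tau%:C.
  apply: conj_fixed_real; apply: (mulIf iw0).
  (* Conjugation turns [w] into its inverse; multiplying the conjugated equation by [- w] restores
     the equation of [t], now for its conjugate. *)
  have cancel_w (i v z z' : C) : v * z = 1 -> z' * (- i * (1 + z)) = 1 - z ->
      z' * (i * (1 + v)) = 1 - v.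
    move=> vz eq1; transitivity (z' * i * (v * z + v)); first by rewrite vz mulrA.
    transitivity (- v * (z' * (- i * (1 + z)))); first by ring.
    by rewrite eq1; transitivity (v * z - v); [ring | rewrite vz].
  rewrite tE; apply: (cancel_w _ _ _ _ ww); have := congr1 Num.conj tE.
  by rewrite !rmorphM rmorphB rmorphD rmorph1 /= conjCi.
have t0 : t != 0 by apply: contraNneq wn1_0 => t0; rewrite -tE t0 mul0r.
have tau0 : tau != 0 by move: t0; rewrite tauE fmorph_eq0.
pose theta := atan tau.
have pi0 := pi_gt0 R.
have cos0 : 0 < cos theta by rewrite cos_gt0_pihalf // atan_gtNpi2 atan_ltpi2.
have sinE : sin theta = tau * cos theta.
  by rewrite -[tau]atanK /tan -/theta divfK // gt_eqF.
have theta0 : theta != 0.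
  by apply: contraNneq tau0 => th0; rewrite -[tau]atanK -/theta th0 tan0.
have expE : expi theta = (cos theta)%:C * (1 + 'i * t) :> C.
  by rewrite expiE sinE rmorphM /= tauE; ring.
have expNE : expi (- theta) = (cos theta)%:C * (1 - 'i * t) :> C.
  by rewrite expiE cosN sinN sinE rmorphN rmorphM /= tauE; ring.
(* Solving for [w] gives (1 - i t) / (1 + i t), a quotient of e^(-i theta) by e^(i theta). *)
have wE : w = expi (- (2 * theta)).
  apply: (mulIf (expi_neq0 theta)); rewrite -expiD.
  rewrite (_ : - (2 * theta) + theta = - theta); last by ring.
  rewrite expE expNE mulrCA; congr (_ * _).
  by apply/eqP; rewrite -subr_eq0; apply/eqP; rewrite -[RHS](subrr (1 - w)) -{1}tE; ring.
exists theta; split.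
  case: (ltrgtP theta 0) theta0 => // th0 _; [left | right].
    by rewrite atan_gtNpi2.
  by rewrite atan_ltpi2.
rewrite -wE => j.
have x2E : x2 = expi (- phi) * ('i * t) * x1.
  apply: (mulIf w1_0).
  transitivity (expi (- phi) * (e * x2 * (1 + w))).
    by rewrite -[x2 in LHS]mul1r -(expiNM phi); ring.
  by rewrite -x1w -tE; ring.
pose s := 'i * expi (- phi) * (sin theta)%:C.
have sE : (cos theta)%:C / x1 * x2 = s.
  by rewrite /s x2E sinE rmorphM /= -tauE; field.
have -> : raise (cos theta)%:C s (s * w) (- (cos theta)%:C * w) =
    ((cos theta)%:C / x1) *: raise x1 x2 x3 x4.
  rewrite -raiseZ divfK // sE x3E mulrCA sE x4E [w * s]mulrC.
  by congr raise; field.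
exact: commutesZ.
Qed.

End Commutant.

(** * The equivalence, by cases on one locked element *)

Theorem mainTheorem3 (R : realType) (E0 E1 : R) (hE : E0 - E1 != 0)
    (phi : R) (hphi : 0 <= phi < 2 * pi)
    (n : nat) (hn : (1 <= n)%N)
    (L : 'I_n -> 'M[R[i]]_(2 * 2)) (hL : forall j, L j \is normalmx) :
  phase_locking E0 E1 L phi <->
  exists u : 'I_n -> R[i], (forall j, `|u j| = 1) /\
    [\/ exists (a b : 'I_n -> R[i]) (c k m : 'I_n -> R),
          (forall j, u j *: L j = S1 phi (a j) (b j) (c j) (k j) (m j)) /\
          ((exists j, b j != 0) \/
           (exists j l, a j != (c j)%:C /\ m l != 0)),
        exists (a b : 'I_n -> R[i]) (c k m : 'I_n -> R),
          (forall j, u j *: L j = S2 phi (a j) (b j) (c j) (k j) (m j)) /\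
          ((exists j, b j != 0) \/
           (exists j l,
              a j + (m j)%:C * expi (k j) != (c j)%:C /\ m l != 0))
      | exists theta : R,
          (- (pi / 2) < theta < 0 \/ 0 < theta < pi / 2) /\
          exists (a b : 'I_n -> R[i]) (k m : 'I_n -> R),
            (forall j,
               u j *: L j = Stheta phi theta (a j) (b j) (k j) (m j)) /\
            (exists j, b j != 0)].
Proof.
split=> [lock|[u [u1 [[a [b [c [k [m [LS nt]]]]]]|[a [b [c [k [m [LS nt]]]]]]|
    [theta [th [a [b [k [m [LS nt]]]]]]]]]]]; last first.
- exact: (Stheta_locking E0 E1 hL th u1 LS nt).
- exact: (S2_locking E0 E1 hL u1 LS nt).
- exact: (S1_locking E0 E1 hL u1 LS nt).
have [locked [x1 [x2 [x3 [x4 [comm x23]]]]]] := (phase_lockingE E0 E1 phi hL).1 lock.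
have family1 : commuting L (expi phi) 1 0 0 -> _ := locking_S1 hL lock.
have family2 : commuting L 0 0 1 (expi phi) -> _ := locking_S2 hL lock.
(* A vanishing bra part leaves |q><11| alone and leads to the second family. *)
have [x12|] := boolP ((x1 != 0) || (x2 != 0)); last first.
  rewrite negb_or !negbK => /andP[/eqP x10 /eqP x20]; move: comm x23.
  rewrite x10 x20 add0r => comm x30.
  have [u [a [b [c [k [m [u1 LS nt]]]]]]] := family2 (commuting_plus_ket locked comm x30).
  by exists u; split=> //; apply: Or32; exists a, b, c, k, m.
have in_family1 y1 y2 : commuting L y1 y2 0 0 -> (y1 != 0) || (y2 != 0) -> _ :=
  fun cy y0 => family1 (commuting_plus_bra locked cy y0).
(* Unequal norms, which includes a vanishing ket part, isolate |00><p|. *)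
have [d0|d0] := eqVneq (x1 * Num.conj x1 + x2 * Num.conj x2)
                       (x3 * Num.conj x3 + x4 * Num.conj x4); last first.
  have := in_family1 _ _ (commuting_adj_raise hL comm).
  rewrite !mulf_eq0 subr_eq0 (negbTE d0) => /(_ x12)[u [a [b [c [k [m [u1 LS nt]]]]]]].
  by exists u; split=> //; apply: Or31; exists a, b, c, k, m.
(* With equal norms, a nonzero inner product isolates |00><q|; orthogonality leaves only the family
   with an angle. *)
have [kap0|kap0] := eqVneq (x1 * x3 + x2 * x4) 0; last first.
  have x34 : (x3 != 0) || (x4 != 0).
    by apply: contraNT kap0; rewrite negb_or !negbK => /andP[/eqP-> /eqP->]; rewrite !mulr0 addr0.
  have := in_family1 _ _ (commuting_square_adj hL comm).
  rewrite !mulf_eq0 !conjC_eq0 (negbTE kap0) => /(_ x34)[u [a [b [c [k [m [u1 LS nt]]]]]]].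
  by exists u; split=> //; apply: Or31; exists a, b, c, k, m.
have [theta [th commth]] := commuting_theta locked comm x23 x12 d0 kap0.
have [a [b [k [m [LS nt]]]]] := locking_Stheta hL lock commth.
exists (fun=> 1); split=> [j|]; first by rewrite normr1.
apply: Or33; exists theta; split=> //; exists a, b, k, m; split=> // j.
by rewrite scale1r.
Qed.
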